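(* Let $S=[S^\ell,S^r]\subset\mathbb R^n$ be an $n$-cuboid and let $\mathbf M:S\to\mathbb R^{n\times n}$ be a mobility matrix satisfying (C0)–(C3). Assume that there exists a fully decoupled mobility $\mathbf M_0(z)=\mathrm{diag}(\mathbf m_1(z_1),\dots,\mathbf m_n(z_n))$ on $S$ whose scalar mobilities $\mathbf m_j$ are uniformly concave, $\mathbf m_j''\le-\delta$ for some $\delta>0$, and such that there exists $K>0$ for which $$A_K(z):=K\,\mathbf M_0(z)^{-1}-\mathbf M(z)^{-1}\in\mathbb R^{n\times n}\ \text{ is positive definite for all } z\in\mathrm{int}(S).$$ Let $\mu_0,\mu_1\in\mathcal M(\mathbb R;S)$ with $$\int_{\mathbb R}(\mu_0-S^\ell)\,dx=m=\int_{\mathbb R}(\mu_1-S^\ell)\,dx$$ for some $m\in[0,\infty)^n$ and $\boldsymbol\ell_2(\mu_0-S^\ell),\boldsymbol\ell_2(\mu_1-S^\ell)<\infty$. Then: (a) $\mathbf W_{\mathbf M}(\mu_0,\mu_1)$ is finite; in particular $$\mathbf W_{\mathbf M}^2(\mu_0,\mu_1)\le C\big[\boldsymbol\ell_2(\mu_0-S^\ell)+\boldsymbol\ell_2(\mu_1-S^\ell)\big]$$ with a constant $C>0$ depending on $m$. (b) If, moreover, for almost every $x\in\mathbb R$ one has $\mu_0(x),\mu_1(x)\le\tilde S^r$ (component-wise) for some $\tilde S^r\in\mathrm{int}(S)$, then $$\mathbf W_{\mathbf M}^2(\mu_0,\mu_1)\le\tilde C\sum_{j=1}^n\mathbf W_2^2(\mu_{0,j}-S_j^\ell,\mu_{1,j}-S_j^\ell),$$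 with a constant $\tilde C>0$ depending on $m$ and $\tilde S^r$. (The constants may also depend on the fixed data $\mathbf M,\mathbf M_0,K,\delta,S$, but not otherwise on $\mu_0,\mu_1$.)
   Context: $S=[S^\ell,S^r]=\prod_j[S_j^\ell,S_j^r]$ with $S_j^\ell<S_j^r$. $\mathcal M(\mathbb R;A)$ denotes the set of measurable functions $\mathbb R\to A$ (identified almost everywhere). The conditions on $\mathbf M:S\to\mathbb R^{n\times n}$ are: (C0) $\mathbf M$ is continuous on $S$ and smooth on $\mathrm{int}(S)$; (C1) $\mathbf M(z)$ is symmetric positive definite for each $z\in\mathrm{int}(S)$; (C2) $\mathrm D^2\mathbf M(z)[\zeta,\zeta]$ is negative semidefinite for each $z\in\mathrm{int}(S)$, $\zeta\in\mathbb R^n$; (C3) $\mathbf M(z)\nu=0$ if $z\in\partial S$ and $\nu$ is a normal vector to $\partial S$ at $z$. A fully decoupled mobility is a diagonal matrix $\mathrm{diag}(\mathbf m_1(z_1),\dots,\mathbf m_n(z_n))$ with concave functions $\mathbf m_j:[S_j^\ell,S_j^r]\to\mathbb R$, $\mathbf m_j>0$ on $(S_j^\ell,S_j^r)$, $\mathbf m_j(S_j^\ell)=\mathbf m_j(S_j^r)=0$, satisfying (C0) (continuous on the closed intervals, smooth in the interior). For nonnegative measurable $\tilde\mu:\mathbb R\to\mathbb R^n$, $\boldsymbol\ell_2(\tilde\mu)=\int_{\mathbb R}x^2\sum_{j=1}^n\tilde\mu_j(x)\,dx$. $\mathbf W_2$ is the $L^2$-Wasserstein distance between (measures with) nonnegative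 densities on $\mathbb R$ of equal mass and finite second moment, $\mathbf W_2^2(\nu,\tilde\nu)=\inf_{\gamma\in\Gamma(\nu,\tilde\nu)}\int|x-y|^2\,d\gamma$, $\Gamma$ being the set of couplings. Integrals of vector-valued functions are component-wise. Definition of $\mathbf W_{\mathbf M}$. Let $\tilde\phi(z,p)=p^{\mathrm T}\mathbf M(z)^{-1}p$ on $\mathrm{int}(S)\times\mathbb R^n$ and let $\phi:S\times\mathbb R^n\to[0,\infty]$ be its lower semicontinuous envelope, $\phi(\tilde z,\tilde p)=\liminf_{(z,p)\to(\tilde z,\tilde p)}\tilde\phi(z,p)$ (with $(z,p)\in\mathrm{int}(S)\times\mathbb R^n$). For $T>0$, $\mathscr C_T(\hat\mu\to\check\mu)$ is the set of curves $(\mu_t,w_t)_{t\in[0,T]}$ such that: $t\mapsto\mu_t\in\mathcal M(\mathbb R;S)$ is weakly$\ast$-continuous (tested against $C_c^0(\mathbb R;\mathbb R^n)$); $(w_t)$ is a Borel-measurable family in $\mathcal M(\mathbb R;\mathbb R^n)$; $\int_0^T\int_{-R}^R|w_t|\,dx\,dt<\infty$ for each $R>0$; $\partial_t\mu+\partial_xw=0$ in the sense of distributions on $[0,T]\times\mathbb R$; $\mu|_{t=0}=\hat\mu$ and $\mu|_{t=T}=\check\mu$. Then $\mathbf W_{\mathbf M}(\mu_0,\mu_1)=\big[\inf\{\int_0^1\int_{\mathbb R}\phi(\mu_t,w_t)\,dx\,dt:(\mu,w)\in\mathscr C_1(\mu_0\to\mu_1)\}\big]^{1/2}\in[0,\infty]$.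 *)

(* Defs.v *)
From HB Require Import structures.
From mathcomp Require Import all_boot all_order all_algebra.
From mathcomp Require Import all_classical all_reals all_analysis.

Set Implicit Arguments.
Unset Strict Implicit.
Unset Printing Implicit Defensive.

Import Order.TTheory GRing.Theory Num.Theory.
Import numFieldNormedType.Exports.

Local Open Scope classical_set_scope.
Local Open Scope ring_scope.

(* Vectors of R^n are column vectors 'cV[R]_n, with coordinates z j 0. *)

Section Smoothness.
Context {R : realType}.

(* Meant for open U and finite-dimensional V. *)
Fixpoint Ck_on {V W : normedModType R} (k : nat) (U : set V) (f : V -> W) :
    Prop :=
  if k is k'.+1 then
    (forall x, U x -> differentiable f x) /\ (forall v, Ck_on k' U ('D_v f))
  else forall x, U x -> {for x, continuous f}.

Definition smooth_on {V W : normedModType R} (U : set V) (f : V -> W) : Prop :=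
  forall k, Ck_on k U f.

Definition closed_support {T : topologicalType} {V : normedModType R} (f : T -> V) :
    set T :=
  closure [set x | f x != 0].

End Smoothness.

Section Mobility.
Context {R : realType} {n : nat}.
Implicit Types (Sl Sr z v : 'cV[R]_n) (A : 'M[R]_n) (M : 'cV[R]_n -> 'M[R]_n).

Definition qform A v : R := (v^T *m A *m v) 0 0.

Definition posdef A : Prop := A^T = A /\ forall v, v != 0 -> 0 < qform A v.

Definition negsemidef A : Prop := forall v, qform A v <= 0.

Definition cuboid Sl Sr : set 'cV[R]_n :=
  [set z | forall j, Sl j 0 <= z j 0 <= Sr j 0].

Definition boundary (D : set 'cV[R]_n) : set 'cV[R]_n := closure D `\` D°.

(* The normal cone of the convex set D at z. On a face of a cuboid it is the
   ray of outward normals; at edges and corners it is spanned by the normals of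
   the adjacent faces. *)
Definition normal_vector (D : set 'cV[R]_n) z v : Prop :=
  forall y, D y -> (v^T *m (y - z)) 0 0 <= 0.

Record mobility Sl Sr M : Prop := Mobility {
  mobility_cont : {within cuboid Sl Sr, continuous M};
  mobility_smooth : smooth_on (cuboid Sl Sr)° M;
  mobility_posdef : forall z, (cuboid Sl Sr)° z -> posdef (M z);
  (* D^2 M(z)[zeta, zeta] as an iterated directional derivative *)
  mobility_concave : forall z zeta, (cuboid Sl Sr)° z ->
    negsemidef ('D_zeta ('D_zeta M) z);
  mobility_normal : forall z nu, boundary (cuboid Sl Sr) z ->
    normal_vector (cuboid Sl Sr) z nu -> M z *m nu = 0 }.

Record scalar_mobility (a b : R) (f : R -> R) : Prop := ScalarMobility {
  scalar_mobility_concave :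
    convex_function (`[a, b]%classic : set R^o) (fun x => - f x);
  scalar_mobility_gt0 : forall x, a < x < b -> 0 < f x;
  scalar_mobility_left : f a = 0;
  scalar_mobility_right : f b = 0;
  scalar_mobility_cont : {within `[a, b], continuous f};
  scalar_mobility_smooth : smooth_on `]a, b[%classic f }.

Definition decoupled_mobility (m : 'I_n -> R -> R) : 'cV[R]_n -> 'M[R]_n :=
  fun z => diag_mx (\row_j m j (z j 0)).

(* phi is the lower semicontinuous envelope on S x R^n of
   (z, p) |-> p^T M(z)^-1 p, the latter being considered on int(S) x R^n. *)
Definition action_density_int M (zp : 'cV[R]_n * 'cV[R]_n) : \bar R :=
  (qform (invmx (M zp.1)) zp.2)%:E.

Definition action_density Sl Sr M (z p : 'cV[R]_n) : \bar R :=
  limf_einf (action_density_int M)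
    (within ((cuboid Sl Sr)° `*` setT) (nbhs (z, p))).

End Mobility.

Section Wasserstein.
Context {R : realType}.

Notation leb := (@lebesgue_measure R).

Definition coupling (f g : R -> R)
    (gamma : {measure set (measurableTypeR R * measurableTypeR R) -> \bar R}) :
    Prop :=
  forall A : set (measurableTypeR R), measurable A ->
    gamma (A `*` setT) = (\int[leb]_(x in A) (f x)%:E)%E /\
    gamma (setT `*` A) = (\int[leb]_(x in A) (g x)%:E)%E.

(* Distance between the measures with (nonnegative) densities f and g. *)
Definition W2 (f g : R -> R) : \bar R :=
  sqrte (ereal_inf
    [set (\int[gamma]_p ((`|p.1 - p.2| ^+ 2)%:E))%E | gamma in coupling f g]).

End Wasserstein.

Section Transport.
Context {R : realType} {n : nat}.
Implicit Types (Sl Sr z : 'cV[R]_n) (M : 'cV[R]_n -> 'M[R]_n).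

Notation leb := (@lebesgue_measure R).

(* Everywhere-defined representatives; the identification of functions that
   agree almost everywhere is made where equality of densities occurs. *)
Definition meas_into (D : set 'cV[R]_n) (f : R -> 'cV[R]_n) : Prop :=
  (forall j, measurable_fun setT ((fun x => f x j 0) : measurableTypeR R -> R))
  /\ (forall x, D (f x)).

Definition second_moment (f : R -> 'cV[R]_n) : \bar R :=
  (\int[leb]_x (x ^+ 2 * \sum_j f x j 0)%:E)%E.

Definition weak_star_continuous (T : R) (mu : R -> R -> 'cV[R]_n) : Prop :=
  forall eta : R -> 'cV[R]_n, continuous eta -> compact (closed_support eta) ->
    {within `[0, T], continuous
      (fun t => \int[leb]_x (\sum_j eta x j 0 * mu t x j 0))}.

Definition continuity_equation (T : R) (mu w : R -> R -> 'cV[R]_n) : Prop :=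
  forall eta : R * R -> R, smooth_on setT eta ->
    compact (closed_support eta) -> closed_support eta `<=` `]0, T[ `*` setT ->
    forall j, \int[leb]_(t in `[0, T]) \int[leb]_x
      ('D_(1, 0) eta (t, x) * mu t x j 0 + 'D_(0, 1) eta (t, x) * w t x j 0)
      = 0.

Record curve Sl Sr (T : R) (muhat mucheck : R -> 'cV[R]_n)
    (mu w : R -> R -> 'cV[R]_n) : Prop := Curve {
  curve_meas : forall t, 0 <= t <= T -> meas_into (cuboid Sl Sr) (mu t);
  curve_weak_star : weak_star_continuous T mu;
  curve_flux_meas : forall j, measurable_fun
    ((`[0, T]%classic : set (measurableTypeR R)) `*` setT)
    ((fun tx => w tx.1 tx.2 j 0) :
      (measurableTypeR R * measurableTypeR R)%type -> R);
  (* the norm of 'cV[R]_n is the max norm *)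
  curve_flux_integrable : forall r : R, 0 < r ->
    (\int[leb]_(t in `[0%R, T]) \int[leb]_(x in `[(- r)%R, r])
       (`|w t x|)%:E < +oo)%E;
  curve_continuity : continuity_equation T mu w;
  curve_initial : {ae leb, forall x, mu 0 x = muhat x};
  curve_final : {ae leb, forall x, mu T x = mucheck x} }.

(* The time integrals are iterated, so that nothing depends on the choice of
   the representatives of mu t and w t. *)
Definition curve_action Sl Sr M (mu w : R -> R -> 'cV[R]_n) : \bar R :=
  (\int[leb]_(t in `[0%R, 1%R]) \int[leb]_x
     action_density Sl Sr M (mu t x) (w t x))%E.

Definition WM Sl Sr M (mu0 mu1 : R -> 'cV[R]_n) : \bar R :=
  sqrte (ereal_inf [set curve_action Sl Sr M muw.1 muw.2 |
    muw in [set muw | curve Sl Sr 1 mu0 mu1 muw.1 muw.2]]).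

Record admissible Sl Sr (m : 'cV[R]_n) (mu : R -> 'cV[R]_n) : Prop :=
    Admissible {
  admissible_meas : meas_into (cuboid Sl Sr) mu;
  admissible_mass : forall j,
    (\int[leb]_x (mu x j 0 - Sl j 0)%:E = (m j 0)%:E)%E;
  admissible_moment : (second_moment (fun x => mu x - Sl)%R < +oo)%E }.

End Transport.

(* Main.v *)
Require Import Defs.
From HB Require Import structures.
From mathcomp Require Import all_boot all_order all_algebra.
From mathcomp Require Import all_classical all_reals all_analysis.
From mathcomp Require Import measurable_realfun interval_inference ring lra.

(** Write u_j for the j-th component of a density minus S^l_j.  The bound on
    the distance comes from one explicit curve, built separately in each
    component out of quantile functions.

    A density u with 0 <= u <= D and mass m on the line has a quantile function
    G on ]0, m[ that pushes the Lebesgue measure of ]0, m[ to u(x) dx.  The bound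
    u <= D means exactly that G expands: s' - s <= D (G s' - G s) for s < s'.
    For two such functions G0 and G1, let the particle with label s follow
        X_t(s) = a(t) G0(s) + b(t) G1(s),   a(0) = b(1) = 1, a(1) = b(0) = 0,
    with a, b >= 0.  The expansion adds up, so the density rho_t carried by X_t is
    at most D / (a + b), and the label of the particle at x is the mass
    rho_t(]-oo, x]).  Hence the velocity field is explicit, and the continuity
    equation is the fundamental theorem of calculus along each trajectory,
    integrated over the labels.  The curve is S^l + rho_t with flux v_t rho_t
    (path_curve).

    The action of this curve is computed as follows.  Concavity bounds m_j(x) below by
    c (x - S^l_j) (S^r_j - x), and positivity of A_K gives
    p^T M(z)^-1 p <= K sum_j p_j^2 / m_j(z_j); so, passing to the boundary of S by
    lower semicontinuity (action_density_le),
        phi(z, p) <= C sum_j rho_j v_j^2 / (S^r_j - z_j)   when p_j = v_j rho_j.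
    Only the distance of z_j to the upper face is dangerous.  If
    v_j^2 <= B (S^r_j - z_j) Q_j, the factor S^r_j - z_j cancels, and a change of
    variables to labels bounds the action by C B sum_j int Q_j(s) ds
    (WM_sqr_le_path).

    (a) The initial and final densities may touch the upper face.  The
    coefficients are chosen with a + b = 1 + k, where k = t^2 (1 - t)^2, and with
    a', b' of order t (1 - t).  The cloud of particles is thus dilated a little
    in between, which makes room of order k below the face, while the squared
    speed is at most 128 k (G0^2 + G1^2) (dilation_speed).  This gives
    Q = G0^2 + G1^2, whose integral is the sum of the two second moments.

    (b) If both densities stay below an interior point of S, there is always room
    and a = 1 - t, b = t works, with Q = (G0 - G1)^2.  The integral of this Q is at most
    W_2^2 (quantile_cost_le_W2): writing (x - y)^2 as the area of the square
    with side [x, y[ turns the cost of a coupling into an integral over pairs p <= q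
    of the mass carried from ]-oo, p] to ]q, +oo[ and back; for each pair the
    marginals force a minimal mass, and the coupling by quantiles attains it. *)

Set Implicit Arguments.
Unset Strict Implicit.
Unset Printing Implicit Defensive.

Import Order.TTheory GRing.Theory Num.Theory.
Import numFieldNormedType.Exports.

Local Open Scope classical_set_scope.
Local Open Scope ring_scope.

(** * Right derivatives of distribution functions *)

(** The integral of a nonnegative function is a supremum over simple functions
    below it, so this comparison holds without any measurability.  It is
    applied to the action density, a lower limit over neighbourhoods. *)
Lemma le_integral_of_le d (T : measurableType d) (R : realType)
    (mu : {measure set T -> \bar R}) (D : set T) (f g : T -> \bar R) :
  (forall x, D x -> 0 <= g x)%E -> (forall x, D x -> f x <= g x)%E ->
  (\int[mu]_(x in D) f x <= \int[mu]_(x in D) g x)%E.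
Proof.
move=> g0 fg; rewrite integralE.
apply: (@le_trans _ _ (\int[mu]_(x in D) f^\+ x)%E).
  by rewrite -[leRHS]sube0 leeB// integral_ge0.
rewrite !ge0_integralE//; apply: ereal_sup_le => _ [h hf <-]; exists h => //= x.
apply: (le_trans (hf x)); rewrite /patch; case: ifPn => //.
by rewrite inE => Dx; rewrite funeposE ge_max fg//= g0.
Qed.

Section RightDerivative.
Context {R : realType}.
Notation leb := (@lebesgue_measure R).
Implicit Types (F f : R -> R) (L x y : R).

Definition right_quotient F (k : nat) x : R :=
  (F (x + k.+1%:R^-1) - F x) * k.+1%:R.

(** An upper limit along the steps 1/(k+1) is taken because it exists at every
    point: the result is measurable jointly in x and in a parameter, and a
    bound on the increments of F bounds it everywhere.  The densities of the
    curve must take their values in S at every point, not only almost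
    everywhere. *)
Definition right_deriv F x : R :=
  fine (limn_esup (fun k => (right_quotient F k x)%:E)).

Lemma limn_esup_itv (u : R ^nat) a b : (forall k, a <= u k <= b) ->
  (a%:E <= limn_esup (EFin \o u) <= b%:E)%E.
Proof.
move=> uab; rewrite limn_esup_lim; apply/andP; split.
- apply: lime_ge; first exact: is_cvg_esups.
  apply: nearW => k; apply: le_ereal_sup_tmp; exists (u k)%:E.
    by exists k => //=.
  by rewrite lee_fin; case/andP: (uab k).
- apply: lime_le; first exact: is_cvg_esups.
  apply: nearW => k; apply: ge_ereal_sup => _ [i _ <-].
  by rewrite lee_fin; case/andP: (uab i).
Qed.

Lemma right_deriv_itv F L x :
  (forall y, x <= y -> 0 <= F y - F x <= L * (y - x)) ->
  0 <= right_deriv F x <= L.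
Proof.
move=> FL; have : forall k, 0 <= right_quotient F k x <= L.
  move=> k; have k0 : 0 < k.+1%:R :> R by rewrite ltr0n.
  have /andP[q0 qL] : 0 <= F (x + k.+1%:R^-1) - F x <= L * (x + k.+1%:R^-1 - x).
    by apply: FL; rewrite lerDl invr_ge0 ltW.
  rewrite /right_quotient mulr_ge0 ?(ltW k0)//= -ler_pdivlMr// (le_trans qL)//.
  by rewrite addrAC subrr add0r.
move=> /limn_esup_itv; rewrite /right_deriv /comp /=.
case: (limn_esup _) => [r| |//]; first by rewrite !lee_fin.
by rewrite leye_eq/= andbF.
Qed.

Lemma right_derivE F x : derivable F x 1 -> right_deriv F x = F^`()%classic x.
Proof.
move=> dF; rewrite derive1E /right_deriv.
suff h : (fun k => (right_quotient F k x)%:E) @ \oo --> ('D_1 F x)%:E.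
  by rewrite is_cvg_limn_esupE ?(cvg_lim _ h)//; apply/cvg_ex; exists ('D_1 F x)%:E.
apply: cvg_EFin; first exact: nearW.
have /cvgr_dnbhsP/(_ (fun k => k.+1%:R^-1)) :
  h^-1 *: (F (h *: 1 + x) - F x) @[h --> 0^'] --> 'D_1 F x.
  by have /derivableP := dF; case.
move=> h; apply: cvg_trans (h _); last first.
  split; first by move=> k; rewrite invr_eq0 pnatr_eq0.
  exact: cvg_harmonic.
apply: near_eq_cvg; apply: nearW => k /=.
have e : k.+1%:R^-1%:A = k.+1%:R^-1 :> R by exact: mulr1.
rewrite invrK e /right_quotient (addrC x); exact: mulrC.
Qed.

Lemma measurable_right_deriv d (T : measurableType d) (F : T -> R -> R) (a : T -> R) :
  (forall h, measurable_fun setT (fun t => F t (a t + h))) ->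
  measurable_fun setT (fun t => right_deriv (F t) (a t)).
Proof.
move=> mF; rewrite /right_deriv; apply: (measurableT_comp (fine_measurable measurableT)) => //.
apply: measurable_fun_limn_esup => k; apply/measurable_EFinP.
apply: measurable_funM => //; apply: measurable_funB => //.
by have := mF 0; under eq_fun do rewrite addr0.
Qed.

(** This is the Lebesgue differentiation theorem. *)
Lemma ae_right_deriv_cdf F f :
  leb.-integrable setT (EFin \o f) ->
  (forall x, (F x)%:E = \int[leb]_(t in `]-oo, x]) (f t)%:E)%E ->
  {ae leb, forall x, right_deriv F x = f x}.
Proof.
move=> fi FE; have -> : F = fun x => \int[leb]_(t in [set` `]-oo, x]]) f t.
  by apply/funext => x; rewrite /Rintegral -FE.
have h1 : forall y : R, leb.-integrable `]-oo, y] (EFin \o f).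
  by move=> y; exact: integrableS fi.
have h2 : locally_integrable [set: R] f 
  by apply: open_integrable_locally fi; exact: openT.
have h := FTC1Ny h1 h2.
move: h; apply: filterS; first exact: (ae_filter_ringOfSetsType leb).
by move=> x [dF <-]; exact: right_derivE.
Qed.

End RightDerivative.

(** * The density of a distribution with Lipschitz distribution function *)

Section PushforwardMeasure.
Context d (T : measurableType d) (R : realType).
Variables (P : {finite_measure set T -> \bar R}) (g : T -> R).
Hypothesis mg : measurable_fun setT g.

(** The measurability of g is an argument, so that the measure structure can be
    attached to this name. *)
Definition push_finite (mg' : measurable_fun setT g) : set (measurableTypeR R) -> \bar R :=
  pushforward P g.

Let push0 : push_finite mg set0 = 0%E.
Proof. by rewrite /push_finite /pushforward preimage_set0 measure0. Qed.

Let push_ge0 A : (0 <= push_finite mg A)%E.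
Proof. exact: measure_ge0. Qed.

Let push_sigma_additive : semi_sigma_additive (push_finite mg).
Proof. exact: (@measure_semi_sigma_additive _ _ _
  (measure_function_pushforward__canonical__measure_function_Measure P mg)). Qed.

HB.instance Definition _ := isMeasure.Build _ _ _ (push_finite mg)
  push0 push_ge0 push_sigma_additive.

Let push_fin : fin_num_fun (push_finite mg).
Proof.
move=> A mA; rewrite /push_finite /pushforward fin_num_measure//.
by rewrite -[X in measurable X]setTI; exact: mg.
Qed.

HB.instance Definition _ := Measure_isFinite.Build _ _ _ (push_finite mg) push_fin.

End PushforwardMeasure.

(** A null set is covered by countably many intervals of small total length;
    the bound on intervals then makes its nu-measure small too. *)
Lemma dominates_lebesgue (R : realType) (L : R)
    (nu : {measure set (measurableTypeR R) -> \bar R}) :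
  0 <= L -> (forall a b : R, a <= b -> (nu `]a, b]%classic <= (L * (b - a))%:E)%E) ->
  nu `<< (@lebesgue_measure R).
Proof.
move=> L0 nuL; apply/null_content_dominatesP => A mA A0.
apply/eqP; rewrite eq_le measure_ge0 andbT; apply/lee_addgt0Pr => e e0; rewrite add0e.
have e1 : 0 < e / (L + 1) by rewrite divr_gt0// ltr_wpDl.
have A0' : (wlength (@idfun R))^*%mu A = 0%E by rewrite -A0.
have : (wlength (@idfun R))^*%mu A \is a fin_num by rewrite A0'.
have A0'' := A0'.
rewrite outer_measure_open_itv_cover in A0'' *.
move=> /lb_ereal_inf_adherent-/(_ _ e1)[_/= [F]] [Fi AF] <-; rewrite A0'' add0e => Fe.
have nuF k : (nu (F k) <= L%:E * wlength (@idfun R) (F k))%E.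
  have [[a b] ->/=] := Fi k; have [ab|ba] := ltP a b.
    apply: (@le_trans _ _ (nu `]a, b]%classic)); last first.
      by rewrite (wlength_itv_bnd _ _ _ (ltW ab)) -EFinM; exact: nuL (ltW ab).
    apply: le_measure; rewrite ?inE//.
    by apply: subset_itvl; rewrite bnd_simp.
  by rewrite set_itv_ge ?bnd_simp -?leNgt// measure0 wlength0 mule0.
apply: (@le_trans _ _ (\sum_(0 <= k <oo) nu (F k))%E).
  apply: measure_sigma_subadditive => // k; have [ab ->] := Fi k; exact: measurable_itv.
apply: (@le_trans _ _ (\sum_(0 <= k <oo) (L%:E * wlength (@idfun R) (F k)))%E).
  by apply: lee_nneseries => // k _ ; rewrite measure_ge0.
rewrite nneseriesZl; last by move=> k _; exact: wlength_ge0.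
apply: (@le_trans _ _ (L%:E * (e / (L + 1))%:E)%E).
  by rewrite lee_wpmul2l ?lee_fin// ltW.
rewrite -EFinM lee_fin mulrCA ler_piMr ?(ltW e0)// ler_pdivrMr ?ltr_wpDl// mul1r.
by rewrite lerDl.
Qed.

Section DistributionDensity.
Context d (T : measurableType d) (R : realType).
Variables (P : {finite_measure set T -> \bar R}) (g : T -> R) (L : R).
Hypothesis mg : measurable_fun setT g.
Notation leb := (@lebesgue_measure R).

Definition dist_fun (x : R) : R := fine (P [set s | g s <= x]).

Hypothesis L0 : 0 <= L.
Hypothesis gL : forall x y, x <= y -> dist_fun y - dist_fun x <= L * (y - x).

Lemma measurable_preimage_itv (i : interval R) : measurable (g @^-1` [set` i]).
Proof. by rewrite -[X in measurable X]setTI; apply: mg. Qed.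

Lemma dist_funE x : (dist_fun x)%:E = P (g @^-1` `]-oo, x]%classic).
Proof.
rewrite /dist_fun fineK; first by congr (P _); apply/seteqP; split => s /=; rewrite in_itv.
rewrite (_ : [set s | _] = g @^-1` `]-oo, x]%classic).
  exact/fin_num_measure/measurable_preimage_itv.
by apply/seteqP; split => s /=; rewrite in_itv.
Qed.

Lemma dist_fun_itv x y : x <= y ->
  (dist_fun y - dist_fun x)%:E = P (g @^-1` `]x, y]%classic).
Proof.
move=> xy; rewrite EFinB !dist_funE.
have -> : `]x, y]%classic = `]-oo, y]%classic `\` `]-oo, x]%classic.
  apply/seteqP; split => s /=; rewrite !in_itv/=.
    by move=> /andP[xs sy]; split=> //; rewrite leNgt xs.
  by move=> [-> /negP]; rewrite -ltNge => ->.
rewrite setDE preimage_setI preimage_setC -setDE measureD; [|exact: measurable_preimage_itv..|].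
  rewrite (_ : _ `&` _ = g @^-1` `]-oo, x]%classic)//; apply/seteqP; split => s /=;
    rewrite !in_itv/=.
    by case.
  by move=> sx; split => //; exact: le_trans xy.
by rewrite ltey_eq fin_num_measure//; exact: measurable_preimage_itv.
Qed.

Lemma dist_fun_lip x y : x <= y -> 0 <= dist_fun y - dist_fun x <= L * (y - x).
Proof. by move=> xy; rewrite gL// andbT -lee_fin dist_fun_itv. Qed.

Lemma density_itv x : 0 <= right_deriv dist_fun x <= L.
Proof. by apply: right_deriv_itv => y xy; exact: dist_fun_lip. Qed.

Lemma measurable_dist_fun : measurable_fun setT dist_fun.
Proof.
apply: nondecreasing_measurable => // x y xy.
by rewrite -subr_ge0; have /andP[] := dist_fun_lip xy.
Qed.

Lemma measurable_density : measurable_fun setT (right_deriv dist_fun).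
Proof.
apply: (@measurable_right_deriv R _ _ (fun=> dist_fun) id) => h.
by apply: measurableT_comp measurable_dist_fun _; exact: measurable_funD.
Qed.

Lemma push_dominates : push_finite P mg `<< leb.
Proof.
apply: (dominates_lebesgue L0) => a b ab.
rewrite -[X in (X <= _)%E]/(P (g @^-1` `]a, b]%classic)) -dist_fun_itv// lee_fin.
by have /andP[] := dist_fun_lip ab.
Qed.

(** Change of variables for the law of g: a Lipschitz distribution function makes
    the law absolutely continuous, and its right derivative is a version of the
    Radon-Nikodym density. *)
Lemma ge0_integral_density (h : R -> \bar R) :
  measurable_fun setT h -> (forall x, 0 <= h x)%E ->
  (\int[leb]_x (h x * (right_deriv dist_fun x)%:E) = \int[P]_s h (g s))%E.
Proof.
move=> mh h0.
set f := Radon_Nikodym_SigmaFinite.f (push_finite P mg) leb.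
have ffin x : f x \is a fin_num by exact: Radon_Nikodym_SigmaFinite.f_fin_num push_dominates _.
have fi : leb.-integrable setT f by exact: Radon_Nikodym_SigmaFinite.f_integrable push_dominates.
have ae_f : {ae leb, forall x, right_deriv dist_fun x = fine (f x)}.
  apply: ae_right_deriv_cdf.
    by apply: eq_integrable fi => // x _ /=; rewrite fineK.
  move=> x; rewrite dist_funE -[LHS]/(push_finite P mg `]-oo, x]%classic).
  rewrite (Radon_Nikodym_SigmaFinite.f_integral push_dominates)//.
  by apply: eq_integral => y _; rewrite fineK.
transitivity (\int[leb]_x (h x * f x))%E.
  apply: ae_eq_integral => //.
  - apply: emeasurable_funM => //; apply/measurable_EFinP; exact: measurable_density.
  - apply: emeasurable_funM => //; exact: measurable_int fi.
  - move: ae_f; apply: filterS; first exact: (ae_filter_ringOfSetsType leb).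
    by move=> x /= -> _; rewrite fineK.
rewrite (Radon_Nikodym_SigmaFinite.change_of_variables push_dominates)//.
exact: (@ge0_integral_pushforward _ _ _ (measurableTypeR R) R g mg P setT h measurableT mh
  (fun x _ => h0 x)).
Qed.

Lemma integral_density (h : R -> R) : measurable_fun setT h ->
  (\int[leb]_x (h x * right_deriv dist_fun x)%:E = \int[P]_s (h (g s))%:E)%E.
Proof.
move=> mh; rewrite integralE [RHS]integralE.
have r0 x : 0 <= right_deriv dist_fun x by case/andP: (density_itv x).
congr (_ - _)%E.
- transitivity (\int[leb]_x ((EFin \o h)^\+ x * (right_deriv dist_fun x)%:E))%E.
    apply: eq_integral => x _; rewrite !funeposE /= EFinM.
    by rewrite maxe_pMl ?lee_fin// mul0e.
  rewrite ge0_integral_density//; last exact/measurable_funepos/measurable_EFinP.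
  by apply: eq_integral => s _; rewrite !funeposE.
- transitivity (\int[leb]_x ((EFin \o h)^\- x * (right_deriv dist_fun x)%:E))%E.
    apply: eq_integral => x _; rewrite !funenegE /comp EFinM.
    by rewrite maxe_pMl ?lee_fin// mul0e mulNe.
  rewrite ge0_integral_density//; last exact/measurable_funeneg/measurable_EFinP.
  by apply: eq_integral => s _; rewrite !funenegE.
Qed.

End DistributionDensity.

(** * Expanding maps and quantile functions *)

Section UniformMeasure.
Context {R : realType}.
Notation leb := (@lebesgue_measure R).
Implicit Types (m L D x y s : R).

Lemma lebesgue_itv_oo_lty m : (leb `]0%R, m[%classic < +oo)%E.
Proof. by rewrite lebesgue_measure_itv/=; case: ifP => // _; rewrite -EFinB ltry. Qed.

Definition uniform m : {finite_measure set (measurableTypeR R) -> \bar R} :=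
  @mfrestr _ (measurableTypeR R) R `]0%R, m[%classic leb (measurable_itv `]0%R, m[)
    (lebesgue_itv_oo_lty m).

Lemma uniformE m (A : set R) : uniform m A = leb (A `&` `]0, m[).
Proof. by []. Qed.

Lemma ae_uniform m (Q : R -> Prop) : (forall s, 0 < s < m -> Q s) ->
  {ae uniform m, forall s : R, Q s}.
Proof.
move=> h; exists (~` `]0, m[%classic); split; first exact: measurableC.
  by rewrite uniformE setICl measure0.
by move=> s /= nQ; rewrite in_itv/= => /h.
Qed.

(** The lower bound 1/L on the slope of g, written without division so that
    the case of no mass, L = 0, is covered.  It yields the upper bound L on the
    density of the image of the uniform measure, and unlike that bound it
    behaves additively in g. *)
Definition expanding m L (g : R -> R) :=
  forall s s' : R, 0 < s -> s < s' -> s' < m -> s' - s <= L * (g s' - g s).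

Lemma expanding_lt m L g s s' : 0 <= L -> expanding m L g ->
  0 < s -> s < s' -> s' < m -> g s < g s'.
Proof.
move=> L0 gL s0 ss' sm; rewrite ltNge; apply/negP => gg.
have := gL _ _ s0 ss' sm; apply/negP; rewrite -ltNge.
by rewrite (le_lt_trans (mulr_ge0_le0 L0 _))// ?subr_gt0// subr_le0.
Qed.

Lemma expanding_le m L g s s' : 0 <= L -> expanding m L g ->
  0 < s < m -> 0 < s' < m -> (g s' <= g s) = (s' <= s).
Proof.
move=> L0 gL /andP[s0 sm] /andP[s'0 s'm]; have [ss'|ss'|->] := ltgtP s s'.
- by apply/negbTE; rewrite -ltNge; exact: expanding_lt gL _ _ _.
- by apply/ltW; exact: expanding_lt gL _ _ _.
- by rewrite lexx.
Qed.

(** An expanding map is injective: the label of a particle is recovered from its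
    position as the mass on its left. *)
Lemma dist_fun_expanding m L g s : 0 <= L -> expanding m L g ->
  0 < s < m -> dist_fun (uniform m) g (g s) = s.
Proof.
move=> L0 gL sm; rewrite /dist_fun uniformE.
have -> : [set s' | g s' <= g s] `&` `]0, m[ = `]0, s]%classic.
  apply/seteqP; split => s' /=; rewrite !in_itv/=.
    by move=> [gg s'm]; rewrite -(expanding_le L0 gL)// gg andbT; case/andP: s'm.
  move=> /andP[s'0 s's].
  have s'm : 0 < s' < m by rewrite s'0 (le_lt_trans s's)//; case/andP: sm.
  by rewrite (expanding_le L0 gL).
by case/andP: sm => s0 _; rewrite lebesgue_measure_itv/= lte_fin s0 sube0.
Qed.

(** The labels that g sends into an interval of length l lie within distance
    L l of each other, hence in an interval of that length. *)
Lemma dist_fun_expanding_lip m L g : measurable_fun setT g -> 0 <= L ->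
  expanding m L g -> forall x y, x <= y ->
  dist_fun (uniform m) g y - dist_fun (uniform m) g x <= L * (y - x).
Proof.
move=> mg L0 gL x y xy; rewrite -lee_fin dist_fun_itv// uniformE.
set E := _ `&` _.
have mE : measurable E by apply: measurableI => //; exact: measurable_preimage_itv.
have [E0|/set0P[e Ee]] := eqVneq E set0.
  by rewrite E0 measure0 lee_fin mulr_ge0// subr_ge0.
have EL s s' : E s -> E s' -> s' - s <= L * (y - x).
  rewrite /E/= !in_itv/= => -[/andP[xs sy] /andP[s0 sm]] [/andP[xs' s'y] /andP[s'0 s'm]].
  have [ss'|ss'] := ltP s s'; last by rewrite (le_trans (y := 0)) ?subr_le0 ?mulr_ge0 ?subr_ge0.
  by rewrite (le_trans (gL _ _ s0 ss' s'm))// ler_wpM2l// lerB// ltW.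
have hE : has_inf E.
  by split; [exists e|exists (e - L * (y - x)) => s Es; rewrite lerBlDr -lerBlDl EL].
have sub : E `<=` `[inf E, inf E + L * (y - x)]%classic.
  move=> s Es; rewrite /= in_itv/= ge_inf//=; last by case: hE.
  rewrite -lerBlDr; apply: lb_le_inf; first by exists e.
  by move=> s' Es'; rewrite lerBlDr -lerBlDl EL.
apply: (le_trans (le_measure leb _ _ sub)); rewrite ?inE//.
rewrite [X in (X <= _)%E](lebesgue_measure_itv `[inf E, inf E + L * (y - x)]) /= lte_fin;
  case: ifPn => _.
  by rewrite -EFinB addrAC subrr add0r.
by rewrite lee_fin mulr_ge0// subr_ge0.
Qed.

End UniformMeasure.

Section Quantile.
Context {R : realType}.
Notation leb := (@lebesgue_measure R).
Variables (u : R -> R) (D m : R).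
Hypothesis mu : measurable_fun setT u.
Hypothesis u0 : forall x, 0 <= u x.
Hypothesis uD : {ae leb, forall x, u x <= D}.
Hypothesis um : (\int[leb]_x (u x)%:E = m%:E)%E.
Hypothesis D0 : 0 <= D.

Definition primitive x : R := fine (\int[leb]_(t in `]-oo, x]) (u t)%:E).

Let mu' A : measurable_fun A (EFin \o u).
Proof. by apply/measurable_EFinP; exact: measurable_funTS. Qed.

Lemma primitiveE x : (primitive x)%:E = (\int[leb]_(t in `]-oo, x]) (u t)%:E)%E.
Proof.
rewrite /primitive fineK// ge0_fin_numE ?integral_ge0//; last by move=> *; rewrite lee_fin.
apply: (@le_lt_trans _ _ (\int[leb]_x (u x)%:E)%E); last by rewrite um ltry.
by apply: ge0_subset_integral => //; [exact: mu'|move=> *; rewrite lee_fin].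
Qed.

Lemma primitive_itv x y : x <= y ->
  (primitive y - primitive x)%:E = (\int[leb]_(t in `]x, y]) (u t)%:E)%E.
Proof.
move=> xy; rewrite EFinB !primitiveE.
rewrite (@itv_bndbnd_setU _ _ -oo%O (BRight x) (BRight y)) ?bnd_simp//.
rewrite ge0_integral_setU//=; last 3 first.
- exact: mu'.
- by move=> *; rewrite lee_fin.
- apply/disj_setPS => t /=; rewrite !in_itv/= => -[tx /andP[]].
  by rewrite ltNge tx.
by rewrite addeAC -primitiveE subee// add0e.
Qed.

Lemma primitive_lip x y : x <= y -> 0 <= primitive y - primitive x <= D * (y - x).
Proof.
move=> xy; rewrite -!lee_fin primitive_itv//; apply/andP; split.
  by apply: integral_ge0 => t _; rewrite lee_fin.
apply: (@le_trans _ _ (\int[leb]_(t in `]x, y]) D%:E)%E).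
  apply: ae_ge0_le_integral => //.
  - by move=> *; rewrite lee_fin.
  - exact: mu'.
  - by move: uD; apply: filterS; first exact: (ae_filter_ringOfSetsType leb).
rewrite integral_cst// [X in (_ * X)%E](lebesgue_measure_itv `]x, y]) /= lte_fin; case: ifPn => _.
  by rewrite -EFinB -EFinM.
by rewrite mule0 lee_fin mulr_ge0// subr_ge0.
Qed.

Lemma primitive_ge0 x : 0 <= primitive x.
Proof. by rewrite -lee_fin primitiveE integral_ge0// => *; rewrite lee_fin. Qed.

Lemma primitive_le x : primitive x <= m.
Proof.
rewrite -lee_fin primitiveE -um; by apply: ge0_subset_integral => //; [exact: mu'|move=> *;
  rewrite lee_fin].
Qed.

Lemma primitive_ge_ex s : s < m -> exists x, s <= primitive x.
Proof.
move=> sm; pose S (n : nat) : set R := `]-oo, n%:R]%classic.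
have cv : (\int[leb]_(t in S n) (u t)%:E @[n --> \oo] --> m%:E)%E.
  rewrite -um (_ : [set: _] = \bigcup_n S n).
    apply: ge0_nondecreasing_set_cvg_integral => //.
    - by move=> i j ij; apply/subsetPset; apply: subset_itvl; rewrite bnd_simp ler_nat.
    - by move=> i; exact: measurable_itv.
    - by move=> i; exact: mu'.
    - by move=> *; rewrite lee_fin.
  apply/esym/seteqP; split => // t _; exists (Num.truncn `|t|).+1 => //=.
  by rewrite /S/= in_itv/= (le_trans (ler_norm t))// ltW// truncnS_gt.
have /fine_cvgP[_ /cvgr_ge] := cv.
move=> /(_ s sm)[n _ /(_ n (leqnn n))/= sn]; exists n%:R.
exact: sn.
Qed.

(** The mass of the right half-lines [-n, +oo[ tends to m, and [primitive] is the
    mass of their complement. *)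
Lemma primitive_lt_ex s : 0 < s -> exists x, primitive x < s.
Proof.
move=> s0; pose S (n : nat) : set R := `]- n%:R, +oo[%classic.
have cv : (\int[leb]_(t in S n) (u t)%:E @[n --> \oo] --> m%:E)%E.
  rewrite -um (_ : [set: _] = \bigcup_n S n).
    apply: ge0_nondecreasing_set_cvg_integral => //.
    - by move=> i j ij; apply/subsetPset; apply: subset_itvr; rewrite bnd_simp lerN2 ler_nat.
    - by move=> i; exact: measurable_itv.
    - by move=> i; exact: mu'.
    - by move=> *; rewrite lee_fin.
  apply/esym/seteqP; split => // t _; exists (Num.truncn `|t|).+1 => //=.
  by rewrite /S/= in_itv/= andbT ltrNl (le_lt_trans (ler_norm _))// normrN truncnS_gt.
have msm : m - s < m by rewrite gtrBl.
have /fine_cvgP[[N _ fin] /cvgr_gt] := cv.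
move=> /(_ (m - s) msm)[n _ h]; exists (- (maxn N n)%:R).
have := h (maxn N n) (leq_maxr _ _); rewrite /= ltrBlDr -ltrBlDl.
suff -> : m - fine (\int[leb]_(t in S (maxn N n)) (u t)%:E)%E = primitive (- (maxn N n)%:R) by [].
apply/EFin_inj; rewrite EFinB fineK; last exact: fin (leq_maxl _ _).
rewrite -um -(setUv `]-oo, (- (maxn N n)%:R)%R]%classic) setCitvl.
rewrite ge0_integral_setU//=; last 3 first.
- exact: mu'.
- by move=> *; rewrite lee_fin.
- apply/disj_setPS => t /=; rewrite !in_itv/= andbT => -[tx].
  by rewrite ltNge tx.
by rewrite addeK ?primitiveE//; exact: fin (leq_maxl _ _).
Qed.

(** Outside ]0, m[ the infimum may be that of an empty or unbounded set; the
    value is set to 0 there, on a set that the uniform measure does not charge. *)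
Definition quantile : R -> R :=
  (fun s => inf [set x | s <= primitive x]) \_ `]0, m[.

(** The nontrivial direction uses the continuity of the primitive: the level s is
    reached arbitrarily close to the infimum, hence at it. *)
Lemma quantileP s x : 0 < s < m -> (quantile s <= x) = (s <= primitive x).
Proof.
move=> sm; have [s0 sltm] := andP sm.
rewrite /quantile patchE mem_set; last by rewrite /= in_itv.
have prim_nd x1 x2 : x1 <= x2 -> primitive x1 <= primitive x2.
  by move=> /primitive_lip/andP[]; rewrite subr_ge0.
have hE : has_inf [set x | s <= primitive x].
  split; first exact: primitive_ge_ex.
  have [y ys] := primitive_lt_ex s0; exists y => z /= sz.
  by rewrite leNgt; apply/negP => /ltW/prim_nd; rewrite leNgt (lt_le_trans ys).
apply/idP/idP; last by move=> sx; apply: ge_inf => //; case: hE.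
move=> qx; apply/ler_addgt0Pr => e e0.
have e1 : 0 < e / (D + 1) by rewrite divr_gt0// ltr_wpDl.
have [y /= sy yq] := inf_adherent e1 hE.
have {}yq : y <= x + e / (D + 1) by rewrite (le_trans (ltW yq))// lerD2r.
rewrite (le_trans sy)// (le_trans (prim_nd _ _ yq))// -lerBlDl.
have /primitive_lip/andP[_] : x <= x + e / (D + 1) by rewrite lerDl ltW.
move=> /le_trans; apply; rewrite addrAC subrr add0r mulrCA ler_piMr ?ltW//.
by rewrite ltr_pdivrMr ?ltr_wpDl// mul1r ltrDl.
Qed.

Lemma measurable_quantile : measurable_fun setT quantile.
Proof.
have -> : quantile = quantile \_ `]0, m[.
  by apply/funext => s; rewrite /quantile !patchE; case: ifP.
apply/(measurable_restrictT _ _).1 => //.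
apply: (measurability (@RGenOInfty.G R)) => [|/= _ [_ [x ->] <-]].
  exact: RGenOInfty.measurableE.
rewrite (_ : _ `&` _ = `]0, m[ `&` `]primitive x, +oo[); first exact: measurableI.
by apply/seteqP; split => s /= [sm]; rewrite !in_itv/= !andbT in sm *;
  rewrite sm !ltNge quantileP.
Qed.

Lemma expanding_quantile : expanding m D quantile.
Proof.
move=> s s' s0 ss' s'm; apply/ler_addgt0Pr => e e0.
have sm : 0 < s < m by rewrite s0 (lt_trans ss').
have s'm' : 0 < s' < m by rewrite s'm (lt_trans s0).
have e1 : 0 < e / (D + 1) by rewrite divr_gt0// ltr_wpDl.
have h1 : primitive (quantile s - e / (D + 1)) < s.
  by rewrite ltNge -quantileP// -ltNge gtrBl.
have h2 : s' <= primitive (quantile s') by rewrite -quantileP.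
have qq : quantile s <= quantile s' by rewrite quantileP// (le_trans (ltW ss')).
have : quantile s - e / (D + 1) <= quantile s' by rewrite lerBlDr ler_wpDr// ltW.
move=> /primitive_lip/andP[_ h3].
have h4 : D * (e / (D + 1)) <= e.
  by rewrite mulrCA ler_piMr ?ltW// ltr_pdivrMr ?ltr_wpDl// mul1r ltrDl.
rewrite (le_trans (lerB h2 (ltW h1)))// (le_trans h3)//.
by rewrite opprB addrCA mulrDr [leLHS]addrC lerD2l.
Qed.

Lemma dist_fun_quantile x : dist_fun (uniform m) quantile x = primitive x.
Proof.
rewrite /dist_fun uniformE.
have -> : [set s | quantile s <= x] `&` `]0, m[ =
    if primitive x < m then `]0, primitive x]%classic else `]0, m[%classic.
  apply/seteqP; split=> s /=.
    rewrite in_itv/= => -[qs sm]; rewrite quantileP// in qs.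
    by case: ifPn => _ /=; rewrite in_itv/= ?sm// qs andbT; case/andP: sm.
  case: ifPn; rewrite -?leNgt /= => mx; rewrite /= !in_itv/=.
    by move=> /andP[s0 sx]; rewrite quantileP s0 ?(le_lt_trans sx).
  by move=> sm; split => //; rewrite quantileP// (le_trans _ mx)// ltW; case/andP: sm.
case: ifPn => mx; rewrite lebesgue_measure_itv/= lte_fin.
  case: ifPn => /= [_|]; first by rewrite subr0.
  by rewrite -leNgt => p0; apply/le_anti; rewrite primitive_ge0 p0.
have xm : primitive x = m by apply/le_anti; rewrite primitive_le leNgt.
rewrite xm; case: ifPn => /= [_|]; first by rewrite subr0.
by rewrite -leNgt => p0; apply/le_anti; rewrite -{1}xm primitive_ge0 p0.
Qed.

(** The quantile function transports the uniform measure to u(x) dx. *)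
Lemma ae_density_quantile :
  {ae leb, forall x, right_deriv (dist_fun (uniform m) quantile) x = u x}.
Proof.
apply: ae_right_deriv_cdf; last by move=> x; rewrite dist_fun_quantile primitiveE.
apply/integrableP; split; first exact: mu'.
under eq_integral do rewrite gee0_abs ?lee_fin//.
by rewrite um ltry.
Qed.

End Quantile.

(** * Integration over time and labels *)

Section PlaneMeasurability.
Context {R : realType}.

(** An open set of the plane is the countable union of the products of balls with
    rational centers and radii 1/(k+1) that it contains. *)
Lemma open_plane_measurable (U : set (R * R)) : open U ->
  measurable (U : set (measurableTypeR R * measurableTypeR R)).
Proof.
move=> oU.
pose r (k : nat) : R := k.+1%:R^-1.
pose B (i : rat * rat * nat) : set (R * R) :=
  ball (ratr i.1.1 : R) (r i.2) `*` ball (ratr i.1.2 : R) (r i.2).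
pose C i := if `[< B i `<=` U >] then B i else set0.
have -> : U = \bigcup_i C i.
  apply/seteqP; split => [z Uz|z [i _]]; last first.
    by rewrite /C; case: ifPn => // /asboolP; apply.
  have [e /= e0 eU] : nbhs_ball z U by apply/nbhs_ballP; exact: open_nbhs_nbhs.
  have [k _ /(_ _ (leqnn k))/= ke] : \forall k \near \oo, r k < e / 2.
    have /cvgrPdist_lt/(_ (e/2)) := @cvg_harmonic R.
    move=> /(_ _)[|k _ h]; first by rewrite divr_gt0.
    by exists k => // l /h /=; rewrite sub0r normrN ger0_norm// invr_ge0.
  have r0 : 0 < r k by rewrite invr_gt0.
  have ex x : exists q : rat, ball (ratr q : R) (r k) x.
    have : x - r k < x + r k by rewrite ltrD2l gtrN.
    move=> /rat_in_itvoo[q]; rewrite in_itv/= => qx; exists q.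
    by rewrite /ball/= ltr_distl.
  have [p px] := ex z.1; have [q qz] := ex z.2.
  exists (p, q, k) => //; rewrite /C; case: ifPn => [_//|/asboolP[]].
  move=> [x y]/= [px' qy']; apply: eU; split => /=.
    apply: le_ball (ball_triangle (ball_sym px) px').
    by rewrite [leRHS]splitr ltW// ltrD.
  apply: le_ball (ball_triangle (ball_sym qz) qy').
  by rewrite [leRHS]splitr ltW// ltrD.
apply: countable_bigcupT_measurable => [|i]; first exact: countableP.
by rewrite /C; case: ifPn => // _; apply: measurableX; exact: measurable_ball.
Qed.

Lemma continuous_plane_measurable (f : R * R -> R) : continuous f ->
  measurable_fun setT (f : measurableTypeR R * measurableTypeR R -> R).
Proof.
move=> cf; apply: (measurability (@RGenOpens.G R)) => [|/= _ [_ [a [b ->]] <-]].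
  exact: RGenOpens.measurableE.
rewrite setTI; apply: open_plane_measurable.
by apply: open_comp => // z _; exact: cf.
Qed.

End PlaneMeasurability.

(** Fubini's theorem for a family f t with an integrable bound that does not
    depend on t, whose integral over time vanishes for each label s. *)
Section FubiniZero.
Context d (T : measurableType d) (R : realType).
Variables (P : {sigma_finite_measure set T -> \bar R}) (f : R -> T -> R) (B : T -> R).
Notation leb := (@lebesgue_measure R).
Hypothesis mf : measurable_fun setT (fun z : measurableTypeR R * T => f z.1 z.2).
Hypothesis iB : P.-integrable setT (EFin \o B).
Hypothesis fB : forall t s, 0 <= t <= 1 -> `|f t s| <= B s.
Hypothesis f0 : forall s, (\int[leb]_(t in `[0%R, 1%R]) (f t s)%:E = 0)%E.

Let B0 s : 0 <= B s.
Proof. by apply: (le_trans (normr_ge0 (f 0 s))); apply: fB; rewrite lexx ler01. Qed.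

(* f is cut off outside [0, 1], the only times at which it is controlled. *)
Let g : measurableTypeR R * T -> \bar R :=
  (fun z => (f z.1 z.2)%:E) \_ (`[0%R, 1%R] `*` setT).

Let gE t s : g (t, s) = if 0 <= t <= 1 then (f t s)%:E else 0%E.
Proof.
rewrite /g patchE; case: ifPn => [/set_mem[/=]|/negP h].
  by rewrite in_itv/= => ->.
by case: ifPn => // t01; exfalso; apply: h; rewrite inE; split => //=; rewrite in_itv.
Qed.

Let mg : measurable_fun setT g.
Proof.
apply/(measurable_restrictT _ _).1; first exact: measurableX.
by apply/measurable_EFinP; exact: measurable_funTS.
Qed.

Let fubini_FE t : fubini_F P g t = ((fun t => \int[P]_s (f t s)%:E)%E \_ `[0%R, 1%R]) t.
Proof.
rewrite /fubini_F patchE; case: ifPn => [/set_mem/=|/negP t01].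
  rewrite in_itv/= => t01; apply: eq_integral => s _.
  by rewrite gE t01.
apply: integral0_eq => s _; rewrite gE ifN//; apply/negP => h; apply: t01.
by rewrite inE /= in_itv.
Qed.

Let ig : (leb \x P)%E.-integrable setT g.
Proof.
apply/(integrable12ltyP _ _ mg).
have /integrableP[mB Bfin] := iB.
apply: (@le_lt_trans _ _ (\int[leb]_(t in `[0%R, 1%R]) (\int[P]_s `|(B s)%:E|))%E).
  rewrite [leRHS]integral_mkcond; apply: le_integral_of_le => t _.
    by apply: erestrict_ge0 => t' _; exact: integral_ge0.
  rewrite patchE; case: ifPn => [/set_mem/=|/negP t01].
    rewrite in_itv/= => t01; apply: le_integral_of_le => s _ //.
    by rewrite gE t01 /= lee_fin (ger0_norm (B0 s)); exact: fB.
  rewrite integral0_eq// => s _; rewrite gE ifN ?abse0//; apply/negP => h; apply: t01.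
  by rewrite inE /= in_itv.
rewrite integral_cst//= [X in (_ * X)%E](lebesgue_measure_itv `[0%R, 1%R]) /= lte_fin ltr01.
by rewrite sube0 mule1.
Qed.

Lemma fubini_zero_integrable :
  leb.-integrable `[0%R, 1%R] (fun t => \int[P]_s (f t s)%:E)%E.
Proof.
apply/integrable_mkcond => //.
by apply: eq_integrable (integrable_fubini_F ig) => // t _; exact: fubini_FE.
Qed.

Lemma fubini_zero : (\int[leb]_(t in `[0%R, 1%R]) \int[P]_s (f t s)%:E = 0)%E.
Proof.
rewrite integral_mkcond -(eq_integral _ _ (fun t _ => fubini_FE t)).
have := Fubini ig; rewrite -/(fubini_F P g) /fubini_F => ->.
apply: integral0_eq => s _; rewrite -[RHS](f0 s) [RHS]integral_mkcond.
apply: eq_integral => t _; rewrite gE patchE mem_setE in_itv/=.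
by case: ifP.
Qed.

Lemma fubini_zero_inner_integrable t : 0 <= t <= 1 ->
  P.-integrable setT (fun s => (f t s)%:E).
Proof.
move=> t01; apply: (le_integrable _ _ _ iB) => //.
  apply/measurable_EFinP.
  have h : measurable_fun setT (fun s : T => ((t : measurableTypeR R), s)).
    exact: measurable_fun_pair.
  exact: (measurableT_comp mf h).
by move=> s _; rewrite /= lee_fin (ger0_norm (B0 s)); exact: fB.
Qed.

End FubiniZero.

Section PlaneFTC.
Context {R : realType}.
Notation leb := (@lebesgue_measure R).
Variables (eta : R * R -> R) (g v : R -> R).
Hypothesis deta : forall z, differentiable eta z.
Hypothesis c1 : continuous ('D_(1, 0) eta).
Hypothesis c2 : continuous ('D_(0, 1) eta).
Hypothesis dg : forall t : R, is_derive t 1 g (v t).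
Hypothesis cv : continuous v.

Let cg : continuous g.
Proof.
move=> t; apply: differentiable_continuous; apply/derivable1_diffP.
by have [] := dg t.
Qed.

Let cpair : continuous (fun t : R => (t, g t)).
Proof.
move=> t; apply: differentiable_continuous; apply: differentiable_pair => //.
by apply/derivable1_diffP; have [] := dg t.
Qed.

Lemma is_derive_along_graph (t : R) :
  is_derive t 1 (fun t => eta (t, g t))
    ('D_(1, 0) eta (t, g t) + 'D_(0, 1) eta (t, g t) * v t).
Proof.
have dgt : differentiable g t by apply/derivable1_diffP; have [] := dg t.
have dp : differentiable (fun t => (t, g t)) t by exact: differentiable_pair.
have de : differentiable (fun t => eta (t, g t)) t.
  exact: (differentiable_comp dp (deta _)).
split; first exact: diff_derivable.
rewrite deriveE// (diff_comp dp (deta _)) /=.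
rewrite diff_pair//= (_ : 'd (fun t0 : R => t0) t 1 = 1); last by rewrite diff_val.
have -> : 'd g t 1 = v t by rewrite -deriveE// derive_val.
have -> : (1, v t) = (1, 0) + v t *: (0, 1) :> R * R.
  by congr (_, _) => /=; rewrite ?scaler0 ?addr0 ?add0r //; rewrite /GRing.scale /= mulr1.
rewrite linearD linearZ/= !deriveE//; congr (_ + _).
by rewrite mulrC.
Qed.

Lemma integral_along_graph :
  (\int[leb]_(t in `[0%R, 1%R])
     ('D_(1, 0) eta (t, g t) + 'D_(0, 1) eta (t, g t) * v t)%:E
   = (eta (1, g 1) - eta (0, g 0))%:E)%E.
Proof.
have cd : continuous (fun t => 'D_(1, 0) eta (t, g t) + 'D_(0, 1) eta (t, g t) * v t).
  have cd1 : continuous ('D_(1, 0) eta \o (fun t : R => (t, g t))).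
    by move=> t; apply: continuous_comp; [exact: cpair|exact: c1].
  have cd2 : continuous ('D_(0, 1) eta \o (fun t : R => (t, g t))).
    by move=> t; apply: continuous_comp; [exact: cpair|exact: c2].
  move=> t; apply: cvgD; first exact: cd1.
  by apply: cvgM; [exact: cd2|exact: cv].
have ce : continuous (fun t => eta (t, g t)).
  move=> t; apply: differentiable_continuous; apply/derivable1_diffP.
  by have [] := is_derive_along_graph t.
rewrite EFinB; apply: (@continuous_FTC2 _ _ (fun t => eta (t, g t))) => //.
- exact: continuous_subspaceT.
- split.
  + by move=> t _; have [] := is_derive_along_graph t.
  + by apply: cvg_at_right_filter; exact: ce.
  + by apply: cvg_at_left_filter; exact: ce.
- by move=> t _; rewrite derive1E; have [] := is_derive_along_graph t.
Qed.

End PlaneFTC.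

(** * Test functions *)

Section TestFunctions.
Context {R : realType}.
Notation leb := (@lebesgue_measure R).

Lemma outside_closed_support (T : topologicalType) (V : normedModType R)
    (f : T -> V) x : ~ closed_support f x -> f x = 0.
Proof.
by move=> h; apply/eqP/negPn/negP => fx; apply: h; apply: subset_closure.
Qed.

Lemma continuous_compact_support_bounded (T : topologicalType)
    (V : normedModType R) (f : T -> V) (K : set T) :
  continuous f -> compact K -> (forall x, ~ K x -> f x = 0) ->
  exists2 C : R, 0 <= C & forall x, `|f x| <= C.
Proof.
move=> cf cK f0.
have /compact_bounded[M [_ hM]] : compact [set f x | x in K].
  by apply: continuous_compact => //; exact: continuous_subspaceT.
exists (`|M| + 1); first by rewrite addr_ge0.
move=> x; have [Kx|/f0 ->] := pselect (K x); last by rewrite normr0 addr_ge0.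
by apply: hM; [rewrite (le_lt_trans (ler_norm M))// ltrDl|exists x].
Qed.

Lemma derive_outside_closed_support (V W : normedModType R) (f : V -> W) v x :
  ~ closed_support f x -> 'D_v f x = 0.
Proof.
move=> nx; rewrite /derive; apply: cvg_lim => //; apply: cvg_near_cst.
have : nbhs x (~` closed_support f).
  by apply: open_nbhs_nbhs; split => //; apply: closed_openC; exact: closed_closure.
have cxv : {for (0 : R), continuous (fun h : R => h *: v + x)}.
  by apply: cvgD; [apply: cvgZl; exact: cvg_id|exact: cvg_cst].
rewrite -{1}(add0r x) -{1}(scale0r v) => /cxv => near0.
apply: nbhs_dnbhs; near=> h.
rewrite /= (outside_closed_support nx) (@outside_closed_support _ _ f
  (h *: v + x)) ?subrr ?scaler0//.
by near: h.
Unshelve. all: by end_near. Qed.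

Lemma compact_plane_bounded (K : set (R * R)) : compact K ->
  exists2 r : R, 0 < r & forall z, K z -> `|z.2| <= r.
Proof.
move=> /compact_bounded[M [_ hM]]; exists (`|M| + 1); first by rewrite ltr_wpDl.
move=> z Kz; apply: (@le_trans _ _ `|z|); last first.
  by apply: hM => //; rewrite (le_lt_trans (ler_norm M))// ltrDl.
by rewrite [leRHS]prod_normE le_max lexx orbT.
Qed.

Lemma compact_line_bounded (K : set R) : compact K ->
  exists2 r : R, 0 < r & forall z, K z -> `|z| <= r.
Proof.
move=> /compact_bounded[M [_ hM]]; exists (`|M| + 1); first by rewrite ltr_wpDl.
by move=> z Kz; apply: hM => //; rewrite (le_lt_trans (ler_norm M))// ltrDl.
Qed.

Lemma integrable_bounded_support (f : R -> R) (C r : R) :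
  measurable_fun setT f -> (forall x, `|f x| <= C) ->
  (forall x, r < `|x| -> f x = 0) -> leb.-integrable setT (EFin \o f).
Proof.
move=> mf fC f0.
have -> : EFin \o f = (EFin \o f) \_ `[- r, r]%classic.
  apply/funext => x; rewrite patchE; case: ifPn => // /negP h /=.
  rewrite f0// ltNge; apply/negP => xr; apply: h; rewrite inE /= in_itv/=.
  by rewrite -ler_norml.
rewrite -integrable_mkcond//; apply: measurable_bounded_integrable => //.
- by rewrite [X in (X < _)%E](lebesgue_measure_itv `[- r, r]) /=; case: ifP => // _;
  rewrite -EFinB ltry.
- exact: measurable_funTS.
- exists C; split; first exact: num_real.
  by move=> y Cy x _ /=; rewrite (le_trans (fC x))// ltW.
Qed.

Lemma smooth_on_differentiable (V W : normedModType R) (f : V -> W) z :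
  smooth_on setT f -> differentiable f z.
Proof. by move=> /(_ 1%N)[+ _]; apply. Qed.

Lemma smooth_on_continuous_derive (V W : normedModType R) (f : V -> W) v :
  smooth_on setT f -> continuous ('D_v f).
Proof. by move=> /(_ 1%N)[_ /(_ v) h] z; exact: h. Qed.

End TestFunctions.

Lemma integrableZl_EFin d (T : measurableType d) (R : realType)
    (mu : {measure set T -> \bar R}) (D : set T) (c : R) (f : T -> R) :
  measurable D -> mu.-integrable D (EFin \o f) ->
  mu.-integrable D (EFin \o (fun x => c * f x)).
Proof.
move=> mD fi.
have -> : EFin \o (fun x => c * f x) = (fun x => c%:E * (EFin \o f) x)%E by [].
exact: integrableZl.
Qed.

Definition measurable2 {R : realType} (k : R -> R -> R) :=
  measurable_fun setT (fun z : measurableTypeR R * measurableTypeR R => k z.1 z.2).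

Lemma measurable2_comp (R : realType) d (T : measurableType d) (k : R -> R -> R)
    (f g : T -> R) :
  measurable2 k -> measurable_fun setT f -> measurable_fun setT g ->
  measurable_fun setT (fun z => k (f z) (g z)).
Proof.
move=> mk mf mg.
have h : measurable_fun setT (fun z => ((f z : measurableTypeR R), (g z : measurableTypeR R))).
  exact: measurable_fun_pair.
exact: (measurableT_comp mk h).
Qed.

Lemma measurable2_snd (R : realType) (f : R -> R) : measurable_fun setT f ->
  measurable2 (fun _ => f).
Proof. by move=> mf; exact: (measurableT_comp mf measurable_snd). Qed.

Lemma measurable2_fst (R : realType) (f : R -> R) : measurable_fun setT f ->
  measurable2 (fun x _ => f x).
Proof. by move=> mf; exact: (measurableT_comp mf measurable_fst). Qed.

(** * The interpolation of two maps in one component *)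

Section Path.
Context {R : realType}.
Notation leb := (@lebesgue_measure R).
Variables (m : R) (G0 G1 a b a' b' L : R -> R).
Hypothesis mG0 : measurable_fun setT G0.
Hypothesis mG1 : measurable_fun setT G1.
Hypothesis da : forall t : R, is_derive t 1 a (a' t).
Hypothesis db : forall t : R, is_derive t 1 b (b' t).
Hypothesis ca' : continuous a'.
Hypothesis cb' : continuous b'.

Definition path_map t s := a t * G0 s + b t * G1 s.
Definition path_speed t s := a' t * G0 s + b' t * G1 s.
Definition path_dist t x := dist_fun (uniform m) (path_map t) x.
Definition path_density t x := right_deriv (path_dist t) x.
(** The Eulerian velocity: path_dist t x is the label of the particle that sits at
    x at time t. *)
Definition path_velocity t x := path_speed t (path_dist t x).

Hypothesis L0 : forall t, 0 <= t <= 1 -> 0 <= L t.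
Hypothesis pL : forall t, 0 <= t <= 1 -> expanding m (L t) (path_map t).

Let ca : continuous a.
Proof.
move=> t; apply: differentiable_continuous; apply/derivable1_diffP.
by have [] := da t.
Qed.

Let cb : continuous b.
Proof.
move=> t; apply: differentiable_continuous; apply/derivable1_diffP.
by have [] := db t.
Qed.

Let measurable_comb (f g : R -> R) : continuous f -> continuous g ->
  measurable_fun setT (fun z : measurableTypeR R * measurableTypeR R =>
    f z.1 * G0 z.2 + g z.1 * G1 z.2).
Proof.
move=> cf cg; have mf := continuous_measurable_fun cf.
have mg := continuous_measurable_fun cg.
by apply: measurable_funD; apply: measurable_funM;
  [exact: (measurableT_comp mf)|exact: (measurableT_comp mG0)
  |exact: (measurableT_comp mg)|exact: (measurableT_comp mG1)].
Qed.

Lemma measurable_path_map : measurable2 path_map.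
Proof. exact: measurable_comb. Qed.

Lemma measurable_path_speed : measurable2 path_speed.
Proof. exact: measurable_comb. Qed.

Lemma measurable_path_map1 t : measurable_fun setT (path_map t).
Proof.
by apply: measurable_funD; apply: measurable_funM => //.
Qed.

Lemma measurable_path_dist : measurable2 path_dist.
Proof.
apply: (measurableT_comp (fine_measurable measurableT)).
pose A : set ((measurableTypeR R * measurableTypeR R) * measurableTypeR R) :=
  [set z | path_map z.1.1 z.2 <= z.1.2].
have mA : measurable A.
  have mp : measurable_fun setT (fun z :
    (measurableTypeR R * measurableTypeR R) * measurableTypeR R =>
      path_map z.1.1 z.2).
    by apply: (measurable2_comp measurable_path_map) => //; exact: measurableT_comp.
  rewrite -[A]setTI; apply: measurable_fun_ler => //.
  by apply: measurableT_comp => //.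
have := measurable_fun_xsection (uniform m) mA.
congr (measurable_fun _ _); apply/funext => z /=; congr (uniform m _).
by apply/seteqP; split => s; rewrite /xsection /= inE.
Qed.

Lemma measurable_path_density : measurable2 path_density.
Proof.
apply: (@measurable_right_deriv R _ _ (fun z : measurableTypeR R * measurableTypeR R =>
  path_dist z.1) snd) => h.
by apply: (measurable2_comp measurable_path_dist) => //; exact: measurable_funD.
Qed.

Lemma measurable_path_velocity : measurable2 path_velocity.
Proof.
by apply: (measurable2_comp measurable_path_speed) => //; exact: measurable_path_dist.
Qed.

Lemma measurable_path_density1 t : measurable_fun setT (path_density t).
Proof. exact: (measurable2_comp measurable_path_density). Qed.

Lemma measurable_path_dist1 t : measurable_fun setT (path_dist t).
Proof. exact: (measurable2_comp measurable_path_dist). Qed.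

Lemma measurable_path_speed1 t : measurable_fun setT (path_speed t).
Proof. exact: (measurable2_comp measurable_path_speed). Qed.

Lemma path_lip t : 0 <= t <= 1 -> forall x y, x <= y ->
  path_dist t y - path_dist t x <= L t * (y - x).
Proof.
move=> t01; apply: dist_fun_expanding_lip; [exact: measurable_path_map1|exact: L0|exact: pL].
Qed.

Lemma path_density_itv t x : 0 <= t <= 1 -> 0 <= path_density t x <= L t.
Proof.
move=> t01; apply: density_itv; [exact: measurable_path_map1|exact: path_lip].
Qed.

(** Change of variables to labels.  The integrand may involve the label as well as
    the position, since almost every label is recovered by path_dist. *)
Lemma integral_path_density t (k : R -> R -> R) : 0 <= t <= 1 ->
  measurable2 k ->
  (\int[leb]_x (k x (path_dist t x) * path_density t x)%:E =
   \int[uniform m]_s (k (path_map t s) s)%:E)%E.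
Proof.
move=> t01 mk.
have mkd : measurable_fun setT (fun x => k x (path_dist t x)).
  by apply: (measurable2_comp mk) => //; exact: measurable_path_dist1.
rewrite (integral_density (P := uniform m) (measurable_path_map1 t) (L0 t01) (path_lip t01) mkd).
apply: ae_eq_integral => //.
- by apply/measurable_EFinP; exact: (measurableT_comp mkd (measurable_path_map1 t)).
- apply/measurable_EFinP.
  by apply: (measurable2_comp mk) => //; exact: measurable_path_map1.
- apply: ae_uniform => s sm _; rewrite /path_dist.
  by rewrite (dist_fun_expanding (L0 t01) (pL t01)).
Qed.

Lemma integrable_path_density t (k : R -> R -> R) : 0 <= t <= 1 ->
  measurable2 k ->
  (uniform m).-integrable setT (fun s => (k (path_map t s) s)%:E) ->
  leb.-integrable setT (fun x => (k x (path_dist t x) * path_density t x)%:E).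
Proof.
move=> t01 mk /integrableP[_ ik]; apply/integrableP; split.
  apply/measurable_EFinP; apply: measurable_funM; last exact: measurable_path_density1.
  by apply: (measurable2_comp mk) => //; exact: measurable_path_dist1.
have := @integral_path_density t (fun x s => `|k x s|) t01.
move=> /(_ (measurableT_comp (@normr_measurable R setT) mk))/= ik'.
rewrite (_ :
  integral _ _ _ = (\int[leb]_x (`|k x (path_dist t x)| * path_density t x)%:E)%E);
  first by rewrite ik'.
apply: eq_integral => x _ /=; rewrite normrM [X in _ * X]ger0_norm//.
by case/andP: (path_density_itv x t01).
Qed.

Hypothesis M0 : (\int[uniform m]_s (G0 s ^+ 2)%:E < +oo)%E.
Hypothesis M1 : (\int[uniform m]_s (G1 s ^+ 2)%:E < +oo)%E.

Let integrable_sqr (G : R -> R) : measurable_fun setT G ->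
  (\int[uniform m]_s (G s ^+ 2)%:E < +oo)%E ->
  (uniform m).-integrable setT (fun s => (`|G s|)%:E).
Proof.
move=> mG iG.
have i1 : (uniform m).-integrable setT (fun s => (1 + G s ^+ 2)%:E).
  have -> : (fun s => (1 + G s ^+ 2)%:E) = (fun s => (1%:E + (G s ^+ 2)%:E)%E) by [].
  apply: integrableD => //; first exact: finite_measure_integrable_cst.
  apply/integrableP; split; first by apply/measurable_EFinP; exact: measurable_funX.
  by under eq_integral do rewrite gee0_abs ?lee_fin ?sqr_ge0//.
apply: (le_integrable _ _ _ i1) => //.
  by apply/measurable_EFinP; exact: measurableT_comp.
move=> s _ /=; rewrite lee_fin normr_id [leRHS]ger0_norm ?addr_ge0 ?sqr_ge0//.
rewrite -(real_normK (num_real (G s))).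
have := normr_ge0 (G s); set x := `|G s| => x0; nra.
Qed.

Let bounded01 (f : R -> R) : continuous f ->
  exists2 C : R, 0 <= C & forall t, 0 <= t <= 1 -> `|f t| <= C.
Proof.
move=> cf; have /compact_bounded[M [_ hM]] : compact [set f x | x in `[0%R, 1%R]%classic].
  by apply: continuous_compact; [exact: continuous_subspaceT|exact: segment_compact].
exists (`|M| + 1); first by rewrite addr_ge0.
move=> t t01; apply: hM; first by rewrite (le_lt_trans (ler_norm M))// ltrDl.
by exists t => //=; rewrite in_itv.
Qed.

Lemma path_speed_bound : exists2 B : R -> R,
  (uniform m).-integrable setT (EFin \o B) &
  forall t s, 0 <= t <= 1 -> `|path_speed t s| <= B s.
Proof.
have [A A0 hA] := bounded01 ca'; have [B B0 hB] := bounded01 cb'.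
exists (fun s => A * `|G0 s| + B * `|G1 s|).
  have -> : EFin \o (fun s => A * `|G0 s| + B * `|G1 s|) =
     (fun s => A%:E * (`|G0 s|)%:E + B%:E * (`|G1 s|)%:E)%E by [].
  by apply: integrableD => //; apply: integrableZl => //; exact: integrable_sqr.
move=> t s t01; rewrite /path_speed (le_trans (ler_normD _ _))// !normrM.
by apply: lerD; apply: ler_wpM2r => //; [exact: hA|exact: hB].
Qed.

Lemma path_flux_bound : exists2 B : R, 0 <= B & forall t, 0 <= t <= 1 ->
  (\int[leb]_x (`|path_velocity t x * path_density t x|)%:E <= B%:E)%E.
Proof.
have [B iB hB] := path_speed_bound.
exists (fine (\int[uniform m]_s `|(B s)%:E|)).
  by apply: fine_ge0; exact: integral_ge0.
move=> t t01; have /integrableP[mB fB] := iB.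
rewrite fineK; last by rewrite ge0_fin_numE//; exact: integral_ge0.
rewrite (_ :
  integral _ _ _ = (\int[leb]_x (`|path_speed t
  (path_dist t x)| * path_density t x)%:E)%E); last first.
  by apply: eq_integral => x _; rewrite normrM [X in _ * X]ger0_norm//;
    case/andP: (path_density_itv x t01).
rewrite (integral_path_density (k := fun _ s => `|path_speed t s|) t01); last first.
  apply: measurable2_snd;
    exact: (measurableT_comp (@normr_measurable R setT) (measurable_path_speed1 t)).
apply: le_integral_of_le => s _ //=; rewrite lee_fin.
by apply: (le_trans (hB _ _ t01)); exact: ler_norm.
Qed.

(** In labels the integral is that of e along the trajectories, which depends
    continuously on t by dominated convergence. *)
Lemma path_weak_continuous (e : R -> R) (C : R) : continuous e ->
  (forall x, `|e x| <= C) ->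
  {within `[0, 1], continuous (fun t => \int[leb]_x (e x * path_density t x))}.
Proof.
move=> ce eC; have me := continuous_measurable_fun ce.
pose I t := \int[uniform m]_s e (path_map t s).
have cI : {in (`](- 1)%R, 2%R[%classic : set R), continuous I}.
  (* The interval ]-1, 2[ is just an open set around [0, 1]. *)
  apply: (@continuity_under_integral R _ _ (uniform m) (fun t s =>
    e (path_map t s)) setT _ (-1) 2 _ _ (cst C)) => //.
  - move=> t _; apply: measurable_bounded_integrable => //.
    + by rewrite -ge0_fin_numE// fin_num_measure.
    + exact: (measurableT_comp me (measurable_path_map1 t)).
    + exists C; split; first exact: num_real.
      by move=> y Cy s _ /=; rewrite (le_trans (eC _))// ltW.
  - apply: nearW => s _ t _; apply: continuous_comp; last exact: ce.
    by apply: cvgD; apply: cvgMl; [exact: ca|exact: cb].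
  - exact: finite_measure_integrable_cst.
  - by move=> t _; apply: nearW => s _; exact: eC.
apply: (@subspace_eq_continuous _ _ _ I).
  move=> t /set_mem/=; rewrite in_itv/= => t01; rewrite /I /Rintegral; congr fine.
  by rewrite (integral_path_density (k := fun x _ => e x) t01)//; exact: (measurableT_comp me).
apply: continuous_in_subspaceT => t /set_mem/=; rewrite in_itv/= => /andP[t0 t1].
apply: cI; rewrite inE /= in_itv/=; apply/andP; split; lra.
Qed.

(** In labels the moving part of the integrand is the time derivative of eta
    along the trajectory of s, whose integral over [0, 1] vanishes because eta
    does at both ends.  The constant background c contributes the time
    derivative of eta at fixed x, which integrates to 0 likewise.  Fubini's
    theorem exchanges the integrals over time and over labels. *)
Lemma path_continuity_equation (c : R) (eta : R * R -> R) :
  smooth_on setT eta -> compact (closed_support eta) ->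
  closed_support eta `<=` `]0%R, 1%R[ `*` setT ->
  \int[leb]_(t in `[0%R, 1%R]) \int[leb]_x
    ('D_(1, 0) eta (t, x) * (c + path_density t x) +
     'D_(0, 1) eta (t, x) * (path_velocity t x * path_density t x)) = 0.
Proof.
move=> seta ceta eta01.
have deta z := smooth_on_differentiable z seta.
have c1 : continuous ('D_(1, 0) eta) by exact: smooth_on_continuous_derive.
have c2 : continuous ('D_(0, 1) eta) by exact: smooth_on_continuous_derive.
have [C1 C10 hC1] := continuous_compact_support_bounded c1 ceta
  (@derive_outside_closed_support _ _ _ eta _).
have [C2 C20 hC2] := continuous_compact_support_bounded c2 ceta
  (@derive_outside_closed_support _ _ _ eta _).
have eta0 x : eta (0, x) = 0.
  by apply: outside_closed_support => /eta01[/=]; rewrite in_itv/= ltxx.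
have eta1 x : eta (1, x) = 0.
  by apply: outside_closed_support => /eta01[/=]; rewrite in_itv/= ltxx andbF.
have m1 : measurable2 (fun t x => 'D_(1, 0) eta (t, x)).
  have := continuous_plane_measurable c1.
  by apply: eq_measurable_fun => -[].
have m2 : measurable2 (fun t x => 'D_(0, 1) eta (t, x)).
  have := continuous_plane_measurable c2.
  by apply: eq_measurable_fun => -[].
have [r r0 hr] := compact_plane_bounded ceta.
(* The background term is dominated by a multiple of the indicator of an
   interval that contains the projection of the support. *)
pose f1 t x := 'D_(1, 0) eta (t, x).
pose B1 x := C1 * \1_(`[- r, r]%classic : set R) x.
have iB1 : leb.-integrable setT (EFin \o B1).
  apply: (@integrable_bounded_support R B1 C1 r).
  - by apply: measurable_funM => //; exact: measurable_indic.
  - move=> x; rewrite /B1 normrM ger0_norm// ler_piMr// indicE.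
    by case: (_ \in _); rewrite ?normr1 ?normr0.
  - move=> x rx; rewrite /B1 indicE memNset ?mulr0//= in_itv/= -ler_norml.
    by apply/negP; rewrite -ltNge.
have f1B t x : 0 <= t <= 1 -> `|f1 t x| <= B1 x.
  move=> _; have [xr|rx] := leP `|x| r.
    rewrite /B1 indicE mem_set; last by rewrite /= in_itv/= -ler_norml.
    by rewrite mulr1; exact: hC1.
  rewrite /f1 derive_outside_closed_support ?normr0.
    by rewrite /B1 mulr_ge0// indicE.
  by move=> /hr /=; rewrite leNgt rx.
have f10 x : (\int[leb]_(t in `[0%R, 1%R]) (f1 t x)%:E = 0)%E.
  have := @integral_along_graph R eta (cst x) (cst 0) deta c1 c2 _ (@cst_continuous _ _ _).
  move=> /(_ (fun t => is_derive_cst _ _ _)); rewrite /= eta0 eta1 subrr => h.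
  rewrite -[RHS]h; apply: eq_integral => t _; by rewrite mulr0 addr0.
(* The moving term is dominated through the bound on the speed. *)
pose f2 t s := 'D_(1, 0) eta (t, path_map t s) + 'D_(0, 1) eta (t, path_map t s) * path_speed t s.
have [B hB1 hB] := path_speed_bound.
pose B2 s := C1 + C2 * B s.
have iB2 : (uniform m).-integrable setT (EFin \o B2).
  have -> : EFin \o B2 = (fun s => C1%:E + C2%:E * (B s)%:E)%E by [].
  by apply: integrableD => //; [exact: finite_measure_integrable_cst|exact: integrableZl].
have f2B t s : 0 <= t <= 1 -> `|f2 t s| <= B2 s.
  move=> t01; rewrite (le_trans (ler_normD _ _))// lerD// normrM.
  by rewrite ler_pM//; exact: hB.
have f20 s : (\int[leb]_(t in `[0%R, 1%R]) (f2 t s)%:E = 0)%E.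
  have := @integral_along_graph R eta (path_map^~ s) (path_speed^~ s) deta c1 c2.
  rewrite eta0 eta1 subrr; apply.
    move=> t; have := is_deriveD (is_deriveZ (G0 s) (da t)) (is_deriveZ (G1 s) (db t)).
    rewrite (_ : G0 s \*: a + G1 s \*: b = path_map^~ s); last first.
      by apply/funext => t'; rewrite /path_map ![_ * G0 s]mulrC ![_ * G1 s]mulrC.
    by rewrite /path_speed ![_ * G0 s]mulrC ![_ * G1 s]mulrC.
  by move=> t; apply: cvgD; apply: cvgMl; [exact: ca'|exact: cb'].
have mf2 : measurable2 f2.
  apply: measurable_funD; last apply: measurable_funM; last exact: measurable_path_speed.
    by apply: (measurable2_comp m1) => //; exact: measurable_path_map.
  by apply: (measurable2_comp m2) => //; exact: measurable_path_map.
have n1 t : 0 <= t <= 1 -> (\int[leb]_x f1 t x)%:E = (\int[leb]_x (f1 t x)%:E)%E.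
  move=> t01; rewrite fineK//; apply: integrable_fin_num => //.
  exact: (fubini_zero_inner_integrable m1 iB1 f1B t01).
have n2 t : 0 <= t <= 1 ->
    (\int[uniform m]_s f2 t s)%:E = (\int[uniform m]_s (f2 t s)%:E)%E.
  move=> t01; rewrite fineK//; apply: integrable_fin_num => //.
  exact: (fubini_zero_inner_integrable mf2 iB2 f2B t01).
have z1 : \int[leb]_(t in `[0%R, 1%R]) \int[leb]_x f1 t x = 0.
  rewrite /Rintegral -[RHS]/(fine 0%E) -(fubini_zero m1 iB1 f1B f10); congr fine.
  by apply: eq_integral => t /set_mem/=; rewrite in_itv/= => /n1.
have z2 : \int[leb]_(t in `[0%R, 1%R]) \int[uniform m]_s f2 t s = 0.
  rewrite /Rintegral -[RHS]/(fine 0%E) -(fubini_zero mf2 iB2 f2B f20); congr fine.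
  by apply: eq_integral => t /set_mem/=; rewrite in_itv/= => /n2.
have i1 : leb.-integrable `[0%R, 1%R] (EFin \o (fun t => \int[leb]_x f1 t x)).
  apply: eq_integrable (fubini_zero_integrable m1 iB1 f1B) => //.
  by move=> t /set_mem/=; rewrite in_itv/= => /n1.
have i2 : leb.-integrable `[0%R, 1%R] (EFin \o (fun t => \int[uniform m]_s f2 t s)).
  apply: eq_integrable (fubini_zero_integrable mf2 iB2 f2B) => //.
  by move=> t /set_mem/=; rewrite in_itv/= => /n2.
have inner t : 0 <= t <= 1 ->
  \int[leb]_x ('D_(1, 0) eta (t, x) * (c + path_density t x) +
     'D_(0, 1) eta (t, x) * (path_velocity t x * path_density t x)) =
  c * \int[leb]_x f1 t x + \int[uniform m]_s f2 t s.
  move=> t01.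
  pose k x s := 'D_(1, 0) eta (t, x) + 'D_(0, 1) eta (t, x) * path_speed t s.
  have mk : measurable2 k.
    apply: measurable_funD; last apply: measurable_funM; last first.
    - exact: measurable2_snd (measurable_path_speed1 t).
    - by apply: (measurable2_comp m2).
    - by apply: (measurable2_comp m1).
  have ->: \int[uniform m]_s f2 t s = \int[leb]_x (k x (path_dist t x) * path_density t x).
    by rewrite /Rintegral (integral_path_density t01 mk).
  have if1 : leb.-integrable setT (EFin \o (fun x => f1 t x)).
    exact: (fubini_zero_inner_integrable m1 iB1 f1B t01).
  rewrite -RintegralZl//= -RintegralD//=.
  - by apply: eq_Rintegral => x _; rewrite /k /f1 /path_velocity; ring.
  - exact: integrableZl_EFin.
  - apply: integrable_path_density => //.
    exact: (fubini_zero_inner_integrable mf2 iB2 f2B t01).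
rewrite [LHS](_ : _ = \int[leb]_(t in `[0%R, 1%R])
    (c * \int[leb]_x f1 t x + \int[uniform m]_s f2 t s)); last first.
  apply: eq_Rintegral.
  by move=> t /set_mem/=; rewrite in_itv/= => /inner.
rewrite RintegralD//; last exact: integrableZl_EFin.
by rewrite RintegralZl// z1 z2 mulr0 addr0.
Qed.

End Path.

(** * The upper bound on the action density *)

Section ScalarMobility.
Context {R : realType}.

(** The graph of f lies above the two chords from the endpoints, where f vanishes,
    to the point over the middle; the parabola is below these chords. *)
Lemma scalar_mobility_lower_bound (l r : R) (f : R -> R) :
  l < r -> scalar_mobility l r f ->
  exists2 c, 0 < c & forall x, l <= x <= r -> c * ((x - l) * (r - x)) <= f x.
Proof.
move=> lr sf; pose mid := (l + r) / 2.
have lm : l < mid by rewrite /mid; lra.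
have mr : mid < r by rewrite /mid; lra.
have fm : 0 < f mid by apply: (scalar_mobility_gt0 sf); rewrite lm mr.
have conc (t x y : R) : 0 <= t <= 1 -> l <= x <= r -> l <= y <= r ->
    t * f x + (1 - t) * f y <= f (t * x + (1 - t) * y).
  move=> /andP[t0 t1] xlr ylr.
  have := scalar_mobility_concave sf (Itv01 t0 t1).
  move=> /(_ x y); rewrite !inE/= !in_itv/= => /(_ xlr ylr).
  rewrite !convRE /= /unstable.onem; lra.
exists (f mid / ((mid - l) * (r - l))).
  by rewrite divr_gt0// mulr_gt0// subr_gt0.
move=> x /andP[lx xr].
have d1 : 0 < mid - l by rewrite subr_gt0.
have d2 : 0 < r - l by rewrite subr_gt0.
have md : r - mid = mid - l by rewrite /mid; field.
rewrite mulrAC ler_pdivrMr ?mulr_gt0//.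
have [xm|mx] := leP x mid.
  pose t := (x - l) / (mid - l).
  have t01 : 0 <= t <= 1.
    apply/andP; split; first by rewrite divr_ge0 ?subr_ge0// ltW.
    by rewrite ler_pdivrMr// mul1r lerB.
  have := conc t mid l t01; rewrite lexx (ltW lm) (ltW mr) (ltW lr) => /(_ isT isT).
  rewrite (scalar_mobility_left sf) mulr0 addr0.
  have -> : t * mid + (1 - t) * l = x by rewrite /t; field; rewrite gt_eqF.
  move=> h.
  have : t * (mid - l) = x - l by rewrite /t divfK// gt_eqF.
  move=> tE.
  apply: (@le_trans _ _ (t * f mid * ((mid - l) * (r - l)))).
    rewrite (_ : t * f mid * _ = f mid * ((t * (mid - l)) * (r - l))); last by ring.
    by rewrite tE ler_wpM2l ?ler_wpM2l ?subr_ge0 ?lerB// ltW.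
  by rewrite ler_wpM2r// ltW// mulr_gt0.
pose t := (r - x) / (r - mid).
have d3 : 0 < r - mid by rewrite subr_gt0.
have t01 : 0 <= t <= 1.
  apply/andP; split; first by rewrite divr_ge0 ?subr_ge0// ltW.
  by rewrite ler_pdivrMr// mul1r lerB// ltW.
have := conc t mid r t01; rewrite lexx (ltW lm) (ltW mr) (ltW lr) => /(_ isT isT).
rewrite (scalar_mobility_right sf) mulr0 addr0.
have -> : t * mid + (1 - t) * r = x by rewrite /t; field; rewrite gt_eqF.
move=> h.
have tE : t * (mid - l) = r - x by rewrite /t md divfK// gt_eqF.
apply: (@le_trans _ _ (t * f mid * ((mid - l) * (r - l)))); last first.
  by rewrite ler_wpM2r// ltW// mulr_gt0.
rewrite -tE; have xl : x - l <= r - l by rewrite lerB.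
have [t0 _] := andP t01.
rewrite (_ : f mid * _ = (t * f mid * (mid - l)) * (x - l)); last by ring.
rewrite [leRHS]mulrA; apply: ler_wpM2l => //.
by apply: mulr_ge0; [apply: mulr_ge0 => //|]; exact: ltW.
Qed.

End ScalarMobility.

Section ActionDensityBound.
Context {R : realType} {n : nat}.
Variables (Sl Sr : 'cV[R]_n) (M : 'cV[R]_n -> 'M[R]_n) (m_ : 'I_n -> R -> R) (K : R).

Lemma cuboid_interior (z : 'cV[R]_n) : (forall j, Sl j 0 < z j 0 < Sr j 0) ->
  (cuboid Sl Sr)° z.
Proof.
move=> zS; have : nbhs z [set y : 'cV[R]_n | forall j, Sl j 0 < y j 0 < Sr j 0].
  apply: (@filter_forall _ _ (fun j => [set y :
    'cV[R]_n | Sl j 0 < y j 0 < Sr j 0]) (nbhs z) (nbhs_filter z)) => j.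
  have [zl zr] := andP (zS j).
  have cj : {for z, continuous (fun y : 'cV[R]_n => y j 0)} by exact: coord_continuous.
  have h1 : nbhs z [set y : 'cV[R]_n | Sl j 0 < y j 0] by exact: (cvgr_gt (f := fun y :
    'cV[R]_n => y j 0) (z j 0) cj).
  have h2 : nbhs z [set y : 'cV[R]_n | y j 0 < Sr j 0] by exact: (cvgr_lt (f := fun y :
    'cV[R]_n => y j 0) (z j 0) cj).
  by apply: filterS2 h1 h2 => y /= -> ->.
by apply: filterS => y yS j; have /andP[/ltW -> /ltW ->] := yS j.
Qed.

Lemma interior_cuboid (z : 'cV[R]_n) j : (cuboid Sl Sr)° z -> Sl j 0 < z j 0 < Sr j 0.
Proof.
move=> zS.
have cz : {for (0 : R), continuous (fun h : R => h *: delta_mx j 0 + z)}.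
  by apply: cvgD; [apply: cvgZl; exact: cvg_id|exact: cvg_cst].
have : nbhs (0 *: delta_mx j 0 + z) (cuboid Sl Sr) by rewrite scale0r add0r.
move=> /cz/nbhs_ballP[e /= e0 he].
have hp : ball (0 : R) e (e / 2) by rewrite /ball/= sub0r normrN gtr0_norm; lra.
have hm : ball (0 : R) e (- (e / 2)) by rewrite /ball/= sub0r opprK gtr0_norm; lra.
have := he _ hp j; have := he _ hm j; rewrite !mxE !eqxx/= !mulr1; lra.
Qed.

Lemma qform_diag_mx (d : 'rV[R]_n) v : qform (diag_mx d) v = \sum_j d 0 j * v j 0 ^+ 2.
Proof.
rewrite /qform mul_mx_diag mxE; apply: eq_bigr => j _.
by rewrite !mxE expr2; ring.
Qed.

Lemma invmx_diag_mx (d : 'rV[R]_n) : (forall j, d 0 j != 0) ->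
  invmx (diag_mx d) = diag_mx (\row_j (d 0 j)^-1).
Proof.
move=> d0; have dd : diag_mx d *m diag_mx (\row_j (d 0 j)^-1) = 1%:M.
  rewrite mulmx_diag; apply/matrixP => i j; rewrite !mxE.
  by case: eqP => // ->; rewrite divff.
have [du _] := mulmx1_unit dd.
by rewrite -[LHS]mulmx1 -dd mulKmx.
Qed.

Hypothesis S_lt : forall j, Sl j 0 < Sr j 0.
Hypothesis m_mobility : forall j, scalar_mobility (Sl j 0) (Sr j 0) (m_ j).
Hypothesis K_gt0 : 0 < K.
Hypothesis A_K : forall z, (cuboid Sl Sr)° z ->
  posdef (K *: invmx (decoupled_mobility m_ z) - invmx (M z)).

Lemma qform_le_decoupled z p : (cuboid Sl Sr)° z ->
  qform (invmx (M z)) p <= K * \sum_j p j 0 ^+ 2 / m_ j (z j 0).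
Proof.
move=> zS; have mz j : 0 < m_ j (z j 0).
  by apply: (scalar_mobility_gt0 (m_mobility j)); exact: interior_cuboid.
have [_ /(_ p)] := A_K zS.
have -> : qform (K *: invmx (decoupled_mobility m_ z) - invmx (M z)) p =
    K * \sum_j p j 0 ^+ 2 / m_ j (z j 0) - qform (invmx (M z)) p.
  rewrite /qform mulmxBr mulmxBl -scalemxAr -scalemxAl !mxE; congr (_ * _ - _).
  rewrite /decoupled_mobility invmx_diag_mx; last by move=> j; rewrite mxE gt_eqF.
  have := qform_diag_mx (\row_j ((\row_j m_ j (z j 0)) 0 j)^-1) p.
  rewrite /qform mxE => ->; apply: eq_bigr => j _.
  by rewrite !mxE mulrC.
have [-> _|p0 /(_ isT)] := eqVneq p 0; last by rewrite subr_gt0 => /ltW.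
rewrite /qform mulmx0 mxE; apply: mulr_ge0; [exact: ltW|apply: sumr_ge0 => j _].
by rewrite !mxE expr0n mul0r.
Qed.

(** For p = v (z - Sl) the factor (z_j - Sl_j)^2 of p_j^2 outweighs the zero of m_j
    at Sl_j, and the hypothesis on v^2 compensates the one at Sr_j.  The value at
    a boundary point is a lower limit, so a bound along one sequence of interior
    points suffices: those on the segment from z to the center of the cuboid,
    where the distances to the faces are at least half those of z, whence the
    factor 4. *)
Lemma action_density_le : exists2 C, 0 < C & forall z p v Q : 'cV[R]_n,
  cuboid Sl Sr z ->
  (forall j, p j 0 = v j 0 * (z j 0 - Sl j 0)) ->
  (forall j, v j 0 ^+ 2 <= (Sr j 0 - z j 0) * Q j 0) ->
  (forall j, 0 <= Q j 0) ->
  (action_density Sl Sr M z p <= (C * \sum_j Q j 0 * (z j 0 - Sl j 0))%:E)%E.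
Proof.
have /all_sig2[c c0 hc] : forall j, {c : R | 0 < c &
    forall x, Sl j 0 <= x <= Sr j 0 -> c * ((x - Sl j 0) * (Sr j 0 - x)) <= m_ j x}.
  move=> j; apply: cid2; exact: scalar_mobility_lower_bound.
pose k := \sum_j (c j)^-1.
have ck j : (c j)^-1 <= k.
  by rewrite /k (bigD1 j)//= lerDl sumr_ge0// => i _; rewrite invr_ge0 ltW.
have k0 : 0 <= k by apply: sumr_ge0 => i _; rewrite invr_ge0 ltW.
(* The added 1 keeps the constant positive when n = 0. *)
exists (K * (4 * k) + 1); first by rewrite ltr_wpDl// !mulr_ge0// ltW.
move=> z p v Q zS pv vQ Q0.
have u0 j : 0 <= z j 0 - Sl j 0 by rewrite subr_ge0; case/andP: (zS j).
have w0 j : 0 <= Sr j 0 - z j 0 by rewrite subr_ge0; case/andP: (zS j).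
have S0 : 0 <= \sum_j Q j 0 * (z j 0 - Sl j 0).
  by apply: sumr_ge0 => j _; rewrite mulr_ge0.
pose mid : 'cV[R]_n := 2^-1 *: (Sl + Sr).
pose ze (e : R) := z + e *: (mid - z).
have zeS e : 0 < e < 1 -> (cuboid Sl Sr)° (ze e).
  move=> /andP[e0 e1]; apply: cuboid_interior => j; rewrite !mxE.
  have := u0 j; have := w0 j; have := S_lt j; nra.
rewrite /action_density limf_einfE; apply: ge_ereal_sup => _ [V FV <-].
have [[VA VB] /= [zA pB] AB] := FV.
have cze : {for (0 : R), continuous ze}.
  by apply: cvgD; [exact: cvg_cst|apply: cvgZl; exact: cvg_id].
have : nbhs (ze 0) VA by rewrite /ze scale0r addr0.
have cr : ze e @[e --> 0^'+] --> ze 0 by apply: cvg_at_right_filter; exact: cze.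
move=> /cr near0.
have [e [e0 e1 hV]] : exists e, [/\ 0 < e, e < 2^-1 & V (ze e, p)].
  near (0 : R)^'+ => e; exists e; split.
  - by near: e; exact: nbhs_right_gt.
  - by near: e; apply: nbhs_right_lt.
  - apply: (AB (ze e, p)); first by split => /=; [near: e|exact: nbhs_singleton].
    split => //=; apply: zeS; apply/andP; split.
      by near: e; exact: nbhs_right_gt.
    by near: e; exact: nbhs_right_lt.
apply: (@le_trans _ _ (action_density_int M (ze e, p))).
  by apply: ereal_inf_lbound; exists (ze e, p).
rewrite /action_density_int /= lee_fin.
have eS : (cuboid Sl Sr)° (ze e) by apply: zeS; rewrite e0/=; lra.
apply: (le_trans (qform_le_decoupled p eS)).
suff h j : p j 0 ^+ 2 / m_ j (ze e j 0) <= 4 * k * (Q j 0 * (z j 0 - Sl j 0)).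
  apply: (@le_trans _ _ (K * \sum_j 4 * k * (Q j 0 * (z j 0 - Sl j 0)))).
    by rewrite ler_pM2l//; exact: ler_sum.
  rewrite -mulr_sumr mulrA ler_wpM2r// mulrA; lra.
have := interior_cuboid j eS => /andP[zl zr].
have mb := hc j (ze e j 0); rewrite (ltW zl) (ltW zr) in mb; have {}mb := mb isT.
set A := ze e j 0 - Sl j 0 in mb; set B := Sr j 0 - ze e j 0 in mb.
have A0 : 0 < A by rewrite subr_gt0.
have B0 : 0 < B by rewrite subr_gt0.
have uA : z j 0 - Sl j 0 <= 2 * A.
  rewrite /A !mxE; have := u0 j; have := w0 j; have := S_lt j; nra.
have wB : Sr j 0 - z j 0 <= 2 * B.
  rewrite /B !mxE; have := u0 j; have := w0 j; have := S_lt j; nra.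
have cAB : 0 < c j * (A * B) by rewrite !mulr_gt0.
rewrite ler_pdivrMr; last exact: lt_le_trans mb.
set u := z j 0 - Sl j 0 in uA *; set q := Q j 0.
have q0 : 0 <= q by exact: Q0.
have u0j : 0 <= u by exact: u0.
have h1 : p j 0 ^+ 2 <= 4 * (q * u) * (A * B).
  rewrite pv exprMn; apply: (@le_trans _ _ ((2 * B) * q * (u * (2 * A))));
    last by rewrite le_eqVlt; apply/orP; left; apply/eqP; ring.
  rewrite -/u [X in _ * X]expr2; apply: ler_pM; rewrite ?sqr_ge0 ?mulr_ge0//.
    by apply: (le_trans (vQ j)); rewrite ler_wpM2r.
  by rewrite ler_wpM2l.
apply: (le_trans h1).
apply: (@le_trans _ _ (4 * k * (q * u) * (c j * (A * B)))); last first.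
  by rewrite ler_wpM2l// !mulr_ge0.
have kc : 1 <= k * c j by rewrite -ler_pdivrMr// mul1r.
rewrite (_ : 4 * k * (q * u) * (c j * (A * B)) = (k * c j) * (4 * (q * u) * (A * B))); last by ring.
by rewrite ler_peMl// !mulr_ge0// ltW.
Unshelve. all: by end_near. Qed.

End ActionDensityBound.

(** * The quantile coupling and the Wasserstein distance *)

Section LayerCake.
Context {R : realType}.
Notation leb := (@lebesgue_measure R).

Lemma measurable_le_set d (T : measurableType d) (f g : T -> R) :
  measurable_fun setT f -> measurable_fun setT g ->
  measurable [set z | f z <= g z].
Proof.
by move=> mf mg; rewrite -[X in measurable X]setTI; apply: measurable_fun_ler.
Qed.

Lemma measurable_lt_set d (T : measurableType d) (f g : T -> R) :
  measurable_fun setT f -> measurable_fun setT g ->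
  measurable [set z | f z < g z].
Proof.
by move=> mf mg; rewrite -[X in measurable X]setTI; apply: measurable_fun_ltr.
Qed.

Definition separating_pairs (x y : R) : set (R * R) := `[x, y[ `*` `[x, y[.

(** A name for the Lebesgue measure of the plane, to which its sigma-finiteness
    is attached. *)
Definition plane_measure : set (measurableTypeR R * measurableTypeR R) -> \bar R :=
  (leb \x leb)%E.

HB.instance Definition _ := Measure.on plane_measure.

Let plane_measure_sigma_finite : sigma_finite setT plane_measure.
Proof.
pose I (k : nat) : set (measurableTypeR R) := `[- k%:R, k%:R]%classic.
exists (fun k => I k `*` I k).
  apply/seteqP; split => // -[x y] _.
  exists (maxn (Num.truncn `|x|).+1 (Num.truncn `|y|).+1) => //; split => /=;
    rewrite /I /= in_itv/= -ler_norml ltW// (lt_le_trans (truncnS_gt _))// ler_nat.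
    exact: leq_maxl.
  exact: leq_maxr.
move=> k; split; first by apply: measurableX; exact: measurable_itv.
have Ik : (leb (I k) < +oo)%E.
  rewrite [X in (X < _)%E](lebesgue_measure_itv `[- k%:R, k%:R]) /=.
  by case: ifP => // _; rewrite -EFinB ltry.
rewrite [X in (X < _)%E]product_measure1E; [|exact: measurable_itv..].
by rewrite lte_mul_pinfty// ge0_fin_numE.
Qed.

HB.instance Definition _ := Measure_isSigmaFinite.Build _ _ _ plane_measure
  plane_measure_sigma_finite.

Lemma lebesgue_separating_pairs (x y : R) :
  (plane_measure (separating_pairs x y `|` separating_pairs y x) = ((x - y) ^+ 2)%:E)%E.
Proof.
have half (a b : R) : a <= b -> (plane_measure (separating_pairs a b) = ((b - a) ^+ 2)%:E)%E.
  move=> ab; rewrite [LHS]product_measure1E; [|exact: measurable_itv..].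
  rewrite [X in (X * _)%E](lebesgue_measure_itv `[a,
    b[) [X in (_ * X)%E](lebesgue_measure_itv `[a, b[) /=.
  rewrite lte_fin; case: ifPn => [_|]; first by rewrite -EFinB -EFinM expr2.
  rewrite -leNgt => ba; have -> : a = b by apply/le_anti; rewrite ab.
  by rewrite subrr expr2 !mul0r mul0e.
have none (a b : R) : a <= b -> separating_pairs b a = set0.
  by move=> ab; rewrite /separating_pairs set_itv_ge ?bnd_simp -?leNgt// setX0.
have [xy|/ltW yx] := leP x y.
  by rewrite (none _ _ xy) setU0 half// -sqrrN opprB.
by rewrite (none _ _ yx) set0U half.
Qed.

Definition crossing (T : Type) (X Y : T -> R) (p q : R) : set T :=
  [set s | (X s <= p) && (q < Y s)].

Lemma measurable_crossing d (T : measurableType d) (X Y : T -> R) p q :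
  measurable_fun setT X -> measurable_fun setT Y -> measurable (crossing X Y p q).
Proof.
move=> mX mY; rewrite (_ : crossing _ _ _ _ = [set s | X s <= p] `&` [set s | q < Y s]).
  by apply: measurableI; [exact: measurable_le_set|exact: measurable_lt_set].
by apply/seteqP; split => s /= => [/andP[]|[? ?]]; last apply/andP.
Qed.

(** Of the mass a that X puts on ]-oo, p], at most b can end up in ]-oo, q] under
    Y. *)
Lemma crossing_ge d (T : measurableType d) (g : {measure set T -> \bar R})
    (X Y : T -> R) (p q a b : R) :
  measurable_fun setT X -> measurable_fun setT Y ->
  g [set s | X s <= p] = a%:E -> g [set s | Y s <= q] = b%:E ->
  ((Num.max (a - b) 0)%:E <= g (crossing X Y p q))%E.
Proof.
move=> mX mY ga gb; rewrite EFin_max ge_max measure_ge0 andbT EFinB leeBlDr// -ga -gb.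
have mc := measurable_crossing p q mX mY.
have m1 := measurable_le_set mX (measurable_cst p).
have m2 := measurable_le_set mY (measurable_cst q).
apply: (@le_trans _ _ (g (crossing X Y p q `|` [set s | Y s <= q]))); last exact: measureU2.
apply: le_measure; rewrite ?inE//; first exact: measurableU.
by move=> s /= Xp; rewrite /crossing /= Xp; have [sq|qs] := leP (Y s) q; [right|left].
Qed.

Section Exchange.
Context d (T : measurableType d).
Variables (P : {finite_measure set T -> \bar R}) (X Y : T -> R).
Hypothesis mX : measurable_fun setT X.
Hypothesis mY : measurable_fun setT Y.

Let A1 : set (T * (measurableTypeR R * measurableTypeR R)) :=
  [set z | separating_pairs (X z.1) (Y z.1) z.2].
Let A2 : set (T * (measurableTypeR R * measurableTypeR R)) :=
  [set z | separating_pairs (Y z.1) (X z.1) z.2].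

Let mA (X' Y' : T -> R) : measurable_fun setT X' -> measurable_fun setT Y' ->
  measurable ([set z | separating_pairs (X' z.1) (Y' z.1) z.2] :
    set (T * (measurableTypeR R * measurableTypeR R))).
Proof.
move=> mX' mY'.
have mX1 : measurable_fun setT (fun z : T * (measurableTypeR R * measurableTypeR R) => X' z.1).
  exact: (measurableT_comp mX').
have mY1 : measurable_fun setT (fun z : T * (measurableTypeR R * measurableTypeR R) => Y' z.1).
  exact: (measurableT_comp mY').
have ma : measurable_fun setT (fun z : T * (measurableTypeR R * measurableTypeR R) => z.2.1 : R).
  exact: (measurableT_comp measurable_fst measurable_snd).
have mb : measurable_fun setT (fun z : T * (measurableTypeR R * measurableTypeR R) => z.2.2 : R).
  exact: (measurableT_comp measurable_snd measurable_snd).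
rewrite (_ : [set z | _] =
  ([set z | X' z.1 <= z.2.1] `&` [set z | z.2.1 < Y' z.1]) `&`
  ([set z | X' z.1 <= z.2.2] `&` [set z | z.2.2 < Y' z.1])).
  apply: measurableI; apply: measurableI;
   by [exact: measurable_le_set|exact: measurable_lt_set].
apply/seteqP; split => -[s [a b]] /=; rewrite /separating_pairs /= !in_itv/=.
  by move=> [/andP[-> ->] /andP[-> ->]].
by move=> [[-> ->] [-> ->]].
Qed.

(** Layer-cake formula: (x - y)^2 is the area of a square, and Tonelli's theorem
    exchanges the integral over s with that over the points of the squares. *)
Lemma integral_sqr_dist_layer :
  (\int[P]_s ((X s - Y s) ^+ 2)%:E =
   \int[plane_measure]_z
     (P (crossing X Y (Num.min z.1 z.2) (Num.max z.1 z.2)) +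
      P (crossing Y X (Num.min z.1 z.2) (Num.max z.1 z.2))))%E.
Proof.
have mU : measurable (A1 `|` A2) by apply: measurableU; exact: mA.
have := @indic_fubini_tonelli _ _ _ _ R P plane_measure _ mU.
rewrite indic_fubini_tonelli_FE// indic_fubini_tonelli_GE// => h.
transitivity (\int[P]_s (plane_measure \o xsection (A1 `|` A2)) s)%E.
  apply: eq_integral => s _ /=; rewrite -lebesgue_separating_pairs; congr (plane_measure _).
  by apply/seteqP; split => z; rewrite /xsection /= inE.
rewrite h; apply: eq_integral => -[a b] _ /=.
rewrite -measureU.
- congr (P _); apply/seteqP; split => s;
  rewrite /ysection /= inE /= /A1 /A2 /separating_pairs /crossing /= !in_itv/= !le_min !gt_max.
    by move=> [[/andP[-> ->] /andP[-> ->]]|[/andP[-> ->] /andP[-> ->]]]; [left|right].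
  by move=> [/andP[/andP[-> ->] /andP[-> ->]]|/andP[/andP[-> ->] /andP[-> ->]]]; [left|right].
- exact: measurable_crossing.
- exact: measurable_crossing.
- apply/seteqP; split => // s /= [/andP[Xp _] /andP[_ qX]].
  have : Num.min a b <= Num.max a b by rewrite ge_min !le_max !lexx.
  by rewrite leNgt (lt_le_trans qX).
Qed.

End Exchange.
End LayerCake.

Section QuantileCost.
Context {R : realType}.
Notation leb := (@lebesgue_measure R).
Variables (u0 u1 : R -> R) (D m : R).
Hypothesis mu0 : measurable_fun setT u0.
Hypothesis mu1 : measurable_fun setT u1.
Hypothesis u00 : forall x, 0 <= u0 x.
Hypothesis u10 : forall x, 0 <= u1 x.
Hypothesis u0D : {ae leb, forall x, u0 x <= D}.
Hypothesis u1D : {ae leb, forall x, u1 x <= D}.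
Hypothesis u0m : (\int[leb]_x (u0 x)%:E = m%:E)%E.
Hypothesis u1m : (\int[leb]_x (u1 x)%:E = m%:E)%E.
Hypothesis D0 : 0 <= D.

(* The bound of crossing_ge is attained by a pair of quantile functions. *)
Let quantile_le (v w : R -> R) p q :
  measurable_fun setT v -> measurable_fun setT w ->
  (forall x, 0 <= v x) -> (forall x, 0 <= w x) ->
  {ae leb, forall x, v x <= D} -> {ae leb, forall x, w x <= D} ->
  (\int[leb]_x (v x)%:E = m%:E)%E -> (\int[leb]_x (w x)%:E = m%:E)%E ->
  (uniform m (crossing (quantile v m) (quantile w m) p q) <=
    (Num.max (primitive v p - primitive w q) 0)%:E)%E.
Proof.
move=> mv mw v0 w0 vD wD vm wm; rewrite uniformE.
apply: (@le_trans _ _ (leb `]primitive w q, primitive v p]%classic)); last first.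
  rewrite lebesgue_measure_itv/= lte_fin; case: ifPn => _.
    by rewrite -EFinB lee_fin le_max lexx.
  by rewrite lee_fin le_max lexx orbT.
apply: le_measure; rewrite ?inE//.
  by apply: measurableI => //; apply: measurable_crossing;
    [exact: (measurable_quantile mv v0 vD vm D0)|exact: (measurable_quantile mw w0 wD wm D0)].
move=> s /= [/andP[vp qw]]; rewrite !in_itv/= => sm.
by rewrite -(quantileP mv v0 vD vm D0)// vp andbT ltNge -(quantileP mw w0 wD wm D0)// -ltNge.
Qed.

(** Both costs are integrals of the masses crossing from one side of (p, q) to the
    other, and pointwise in (p, q) no coupling has less crossing mass than the
    quantile functions. *)
Lemma quantile_cost_le_W2 :
  (\int[uniform m]_s ((quantile u0 m s - quantile u1 m s) ^+ 2)%:E <= W2 u0 u1 ^+ 2)%E.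
Proof.
rewrite /W2 sqr_sqrte; last first.
  apply: le_ereal_inf_tmp => _ [g _ <-]; apply: integral_ge0 => z _.
  by rewrite lee_fin sqr_ge0.
apply: le_ereal_inf_tmp => _ [g cg <-].
have gT : (g setT < +oo)%E.
  have [+ _] := cg setT measurableT.
  by rewrite setXTT => ->; rewrite u0m ltry.
(* The coupling is finite because its first marginal is; this makes it an
   instance of the finite measures. *)
pose g' := mfrestr measurableT gT.
have gg' : g' = g :> (set _ -> _) by apply/funext => A; rewrite /g' /mfrestr /mrestr setIT.
rewrite (_ : integral g _ _ = \int[g']_p ((p.1 - p.2) ^+ 2)%:E)%E; last first.
  rewrite gg'; apply: eq_integral => z _; by rewrite real_normK// num_real.
have mq0 := measurable_quantile mu0 u00 u0D u0m D0.
have mq1 := measurable_quantile mu1 u10 u1D u1m D0.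
rewrite (integral_sqr_dist_layer (uniform m) mq0 mq1).
have := integral_sqr_dist_layer g' (@measurable_fst _ _ (measurableTypeR R)
  (measurableTypeR R)) (@measurable_snd _ _ (measurableTypeR R) (measurableTypeR R)).
move=> ->.
apply: le_integral_of_le => -[a b] _ /=; first by rewrite adde_ge0.
have mf1 : measurable_fun setT (fst : measurableTypeR R * measurableTypeR R ->
  R) by exact: measurable_fst.
have mf2 : measurable_fun setT (snd : measurableTypeR R * measurableTypeR R ->
  R) by exact: measurable_snd.
have g1 p : g [set s | ((fst : measurableTypeR R * measurableTypeR R ->
  R) s <= p)%R] = (primitive u0 p)%:E.
  have [+ _] := cg _ (measurable_itv `]-oo, p]); rewrite (primitiveE mu0 u00 u0m) => <-.
  by congr (g _); apply/seteqP; split => s /=; rewrite in_itv/= => // -[].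
have g2 p : g [set s | ((snd : measurableTypeR R * measurableTypeR R ->
  R) s <= p)%R] = (primitive u1 p)%:E.
  have [_ +] := cg _ (measurable_itv `]-oo, p]); rewrite (primitiveE mu1 u10 u1m) => <-.
  by congr (g _); apply/seteqP; split => s /=; rewrite in_itv/= => // -[].
rewrite -!/(g' _) gg'; apply: leeD.
  by apply: (le_trans (quantile_le _ _ mu0 mu1 u00 u10 u0D u1D u0m u1m)); exact: crossing_ge.
by apply: (le_trans (quantile_le _ _ mu1 mu0 u10 u00 u1D u0D u1m u0m)); exact: crossing_ge.
Qed.

End QuantileCost.

(** * The curve and its action *)

Section Auxiliary.
Context {R : realType}.
Notation leb := (@lebesgue_measure R).

Lemma norm_col_le n (v : 'cV[R]_n) : `|v| <= \sum_j `|v j 0|.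
Proof.
rewrite [X in X <= _]mx_normrE; apply: bigmax_le => [|[i j] _ /=].
  by apply: sumr_ge0.
by rewrite ord1 (bigD1 i)//= lerDl sumr_ge0.
Qed.

Lemma Rintegral_sum d (T : measurableType d) (mu : {measure set T -> \bar R}) n
    (f : 'I_n -> T -> R) :
  (forall j, mu.-integrable setT (EFin \o f j)) ->
  \int[mu]_x (\sum_j f j x) = \sum_j \int[mu]_x f j x.
Proof.
move=> fi; apply: EFin_inj; rewrite -sumEFin.
under [RHS]eq_bigr => j _.
  rewrite /Rintegral fineK; last by apply: integrable_fin_num => //; exact: fi.
  over.
rewrite /Rintegral; under [in LHS]eq_integral do rewrite -sumEFin.
rewrite -integral_sum//.
rewrite fineK//; apply: integrable_fin_num => //.
by apply: integrable_sum => // j _; exact: fi.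
Qed.

Lemma cvg_sum_ord n (T : Type) (F : set_system T) (FF : Filter F) (f : 'I_n -> T -> R) (l :
  'I_n -> R) :
  (forall j, f j x @[x --> F] --> l j) ->
  (\sum_j f j x) @[x --> F] --> \sum_j l j.
Proof.
move=> fl; elim: (index_enum _) => [|j s IH].
  by under eq_fun do rewrite big_nil; rewrite big_nil; exact: cvg_cst.
by under eq_fun do rewrite big_cons; rewrite big_cons; exact: cvgD.
Qed.

Lemma sqrte_sqr_le (x y : \bar R) : (0 <= y)%E -> (x <= y)%E -> (sqrte x ^+ 2 <= y)%E.
Proof.
move=> y0 xy; rewrite -[leRHS]sqr_sqrte// lee_sqr ?sqrte_ge0//.
by rewrite lee_sqrt.
Qed.

Lemma quantile_moment (u : R -> R) (D m : R) :
  measurable_fun setT u -> (forall x, 0 <= u x) -> {ae leb, forall x, u x <= D} ->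
  (\int[leb]_x (u x)%:E = m%:E)%E -> 0 <= D ->
  (\int[uniform m]_s (quantile u m s ^+ 2)%:E = \int[leb]_x (x ^+ 2 * u x)%:E)%E.
Proof.
move=> mu u0 uD um D0.
have mq := measurable_quantile mu u0 uD um D0.
have eq := expanding_quantile mu u0 uD um D0.
have lq := dist_fun_expanding_lip mq D0 eq.
have msq : measurable_fun setT (fun x : R => x ^+ 2) by exact: measurable_funX.
rewrite -(integral_density (P := uniform m) mq D0 lq msq).
apply: ae_eq_integral => //.
- apply/measurable_EFinP; apply: measurable_funM => //.
  exact: (measurable_density (P := uniform m) mq lq).
- by apply/measurable_EFinP; exact: measurable_funM.
- have := ae_density_quantile mu u0 uD um D0.
  apply: filterS; first exact: (ae_filter_ringOfSetsType leb).
  by move=> x /= -> _.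
Qed.

End Auxiliary.

Section PathCurve.
Context {R : realType} {n : nat}.
Notation leb := (@lebesgue_measure R).
Variables (Sl Sr : 'cV[R]_n) (m : 'cV[R]_n).
Variables (u0 u1 : 'I_n -> R -> R) (D : 'I_n -> R).
Variables (mu0 mu1 : R -> 'cV[R]_n).
Hypothesis mu0E : forall x j, mu0 x j 0 = Sl j 0 + u0 j x.
Hypothesis mu1E : forall x j, mu1 x j 0 = Sl j 0 + u1 j x.
Hypothesis D0 : forall j, 0 <= D j.
Hypothesis DS : forall j, D j <= Sr j 0 - Sl j 0.
Hypothesis m_u0 : forall j, measurable_fun setT (u0 j).
Hypothesis m_u1 : forall j, measurable_fun setT (u1 j).
Hypothesis u0_ge0 : forall j x, 0 <= u0 j x.
Hypothesis u1_ge0 : forall j x, 0 <= u1 j x.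
Hypothesis u0D : forall j, {ae leb, forall x, u0 j x <= D j}.
Hypothesis u1D : forall j, {ae leb, forall x, u1 j x <= D j}.
Hypothesis u0m : forall j, (\int[leb]_x (u0 j x)%:E = (m j 0)%:E)%E.
Hypothesis u1m : forall j, (\int[leb]_x (u1 j x)%:E = (m j 0)%:E)%E.
Hypothesis u0M : forall j, (\int[leb]_x (x ^+ 2 * u0 j x)%:E < +oo)%E.
Hypothesis u1M : forall j, (\int[leb]_x (x ^+ 2 * u1 j x)%:E < +oo)%E.
Variables (a b a' b' : R -> R).
Hypothesis da : forall t : R, is_derive t 1 a (a' t).
Hypothesis db : forall t : R, is_derive t 1 b (b' t).
Hypothesis ca' : continuous a'.
Hypothesis cb' : continuous b'.
Hypothesis a_ge0 : forall t, 0 <= t <= 1 -> 0 <= a t.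
Hypothesis b_ge0 : forall t, 0 <= t <= 1 -> 0 <= b t.
Hypothesis ab_ge1 : forall t, 0 <= t <= 1 -> 1 <= a t + b t.
Hypothesis a0 : a 0 = 1.
Hypothesis b0 : b 0 = 0.
Hypothesis a1 : a 1 = 0.
Hypothesis b1 : b 1 = 1.

Let G0 j := quantile (u0 j) (m j 0).
Let G1 j := quantile (u1 j) (m j 0).
Let mG0 j : measurable_fun setT (G0 j).
Proof. exact: measurable_quantile (m_u0 j) (u0_ge0 j) (u0D j) (u0m j) (D0 j). Qed.
Let mG1 j : measurable_fun setT (G1 j).
Proof. exact: measurable_quantile (m_u1 j) (u1_ge0 j) (u1D j) (u1m j) (D0 j). Qed.

Let L j t := D j / (a t + b t).

Let ab_gt0 t : 0 <= t <= 1 -> 0 < a t + b t.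
Proof. by move=> /ab_ge1; exact: lt_le_trans. Qed.

Let L0 j t : 0 <= t <= 1 -> 0 <= L j t.
Proof. by move=> t01; rewrite divr_ge0// ltW// ab_gt0. Qed.

Let LD j t : 0 <= t <= 1 -> L j t <= D j.
Proof. by move=> t01; rewrite ler_pdivrMr ?ab_gt0// ler_peMr// ab_ge1. Qed.

Let pL j t : 0 <= t <= 1 -> expanding (m j 0) (L j t) (path_map (G0 j) (G1 j) a b t).
Proof.
move=> t01 s s' s0 ss' s'm; have abt := ab_gt0 t01.
have h0 := expanding_quantile (m_u0 j) (u0_ge0 j) (u0D j) (u0m j) (D0 j) s0 ss' s'm.
have h1 := expanding_quantile (m_u1 j) (u1_ge0 j) (u1D j) (u1m j) (D0 j) s0 ss' s'm.
rewrite /L mulrAC ler_pdivlMr// /path_map -/(G0 j) -/(G1 j) in h0 h1 *.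
have := ler_wpM2l (a_ge0 t01) h0; have := ler_wpM2l (b_ge0 t01) h1; lra.
Qed.

Let rho j := path_density (m j 0) (G0 j) (G1 j) a b.
Let vel j := path_velocity (m j 0) (G0 j) (G1 j) a b a' b'.
Let dist j := path_dist (m j 0) (G0 j) (G1 j) a b.

Let M0 j : (\int[uniform (m j 0%R)]_s (G0 j s ^+ 2)%:E < +oo)%E.
Proof. by rewrite (quantile_moment (m_u0 j) (u0_ge0 j) (u0D j) (u0m j) (D0 j)). Qed.
Let M1 j : (\int[uniform (m j 0%R)]_s (G1 j s ^+ 2)%:E < +oo)%E.
Proof. by rewrite (quantile_moment (m_u1 j) (u1_ge0 j) (u1D j) (u1m j) (D0 j)). Qed.

Definition path_state t x : 'cV[R]_n := \col_j (Sl j 0 + rho j t x).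
Definition path_flux t x : 'cV[R]_n := \col_j (vel j t x * rho j t x).

Let rho_itv j t x : 0 <= t <= 1 -> 0 <= rho j t x <= L j t.
Proof.
move=> t01; have := path_density_itv (mG0 j) (mG1 j) (@L0 j) (@pL j) x t01.
by [].
Qed.

Let state_cuboid t x : 0 <= t <= 1 -> cuboid Sl Sr (path_state t x).
Proof.
move=> t01 j; rewrite mxE; have /andP[r0 rL] := rho_itv j x t01.
by have := LD j t01; have := DS j; lra.
Qed.

Let m_rho j t : measurable_fun setT (rho j t).
Proof. exact: (measurable_path_density1 (m j 0) (mG0 j) (mG1 j) da db). Qed.

(** The components evolve independently, each by the interpolation of the two
    quantile functions. *)
Lemma path_curve : curve Sl Sr 1 mu0 mu1 path_state path_flux.
Proof.
split.
- move=> t t01; split; last by move=> x; exact: state_cuboid.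
  move=> j; rewrite (_ : (fun x => _) = (fun x => Sl j 0 + rho j t x)).
    by apply: measurable_funD => //; exact: m_rho.
  by apply/funext => x; rewrite mxE.
- move=> eta ceta keta.
  have cj j : continuous (fun x => eta x j 0).
    move=> x; apply: (cvg_comp eta (fun v : 'cV[R]_n => v j 0));
      [exact: ceta|exact: coord_continuous].
  have [r r0 hr] := compact_line_bounded keta.
  have eta0 x : ~ closed_support eta x -> eta x = 0 by exact: outside_closed_support.
  have [C C0 hC] := continuous_compact_support_bounded ceta keta eta0.
  have hCj j x : `|eta x j 0| <= C.
    apply: le_trans (hC x); rewrite [leRHS]mx_normrE.
    exact: (le_bigmax _ (fun ij : 'I_n * 'I_1 => `|eta x ij.1 ij.2|) (j, 0)).
  have ij j : leb.-integrable setT (EFin \o (fun x => eta x j 0)).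
    apply: (@integrable_bounded_support R _ C r) => //.
      exact: continuous_measurable_fun.
    move=> x rx; rewrite eta0 ?mxE// => /hr; by rewrite leNgt rx.
  have wc j := path_weak_continuous (mG0 j) (mG1 j) da db (@L0 j) (@pL j) (cj j) (hCj j).
  apply: (@subspace_eq_continuous _ _ _ (fun t => \sum_j (Sl j 0 * \int[leb]_x eta x j 0 +
     \int[leb]_x (eta x j 0 * rho j t x)))).
    move=> t /set_mem/=; rewrite in_itv/= => t01.
    have irho j : leb.-integrable setT (EFin \o (fun x => eta x j 0 * rho j t x)).
      apply: (integrable_path_density (mG0 j) (mG1 j) da db (@L0 j) (@pL j)
        (k := fun x _ => eta x j 0) t01).
        by apply: measurable2_fst; exact: continuous_measurable_fun.
      apply: (@measurable_bounded_integrable _ _ _ (uniform (m j 0)) (fun s =>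
        eta (path_map (G0 j) (G1 j) a b t s) j 0)) => //.
      + by rewrite -ge0_fin_numE// fin_num_measure.
      + apply: (measurableT_comp (f := fun x => eta x j 0)); first exact: continuous_measurable_fun.
        exact: measurable_path_map1.
      + exists C; split; first exact: num_real.
        by move=> y Cy s _ /=; rewrite (le_trans (hCj _ _))// ltW.
    transitivity (\int[leb]_x \sum_j (Sl j 0 * eta x j 0 + eta x j 0 * rho j t x)); last first.
      by apply: eq_Rintegral => x _; apply: eq_bigr => j _; rewrite mxE; ring.
    rewrite Rintegral_sum; last first.
      move=> j; rewrite (_ : EFin \o _ = (fun x =>
        (Sl j 0 * eta x j 0)%:E + (eta x j 0 * rho j t x)%:E)%E)//.
      apply: integrableD => //; last exact: irho.
      exact: (integrableZl_EFin (Sl j 0) measurableT (ij j)).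
    apply: eq_bigr => j _; rewrite RintegralD//; last exact: integrableZl_EFin.
    by rewrite RintegralZl.
  move=> t; apply: cvg_sum_ord => j; apply: cvgD; first exact: cvg_cst.
  exact: wc.
- move=> j; rewrite (_ : (fun tx => _) = (fun tx => vel j tx.1 tx.2 * rho j tx.1 tx.2)).
    apply: measurable_funTS; apply: measurable_funM.
      exact: (measurable_path_velocity (m j 0) (mG0 j) (mG1 j) da db ca' cb').
    exact: (measurable_path_density (m j 0) (mG0 j) (mG1 j) da db).
  by apply/funext => -[t x]; rewrite mxE.
- move=> r r0.
  have /choice[B hB] : forall j, exists B, 0 <= B /\ forall t, 0 <= t <= 1 ->
      (\int[leb]_x (`|vel j t x * rho j t x|)%:E <= B%:E)%E.
    move=> j; have [B B0 hB] := path_flux_bound (mG0 j) (mG1 j) da db ca' cb' (@L0 j)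
      (@pL j) (M0 j) (M1 j).
    by exists B.
  have mflux j t : measurable_fun setT (fun x => (`|vel j t x * rho j t x|)%:E).
    apply/measurable_EFinP; apply: measurableT_comp => //; apply: measurable_funM;
      last exact: m_rho.
    exact: (measurable2_comp (measurable_path_velocity (m j 0) (mG0 j) (mG1 j) da db ca' cb')).
  apply: (@le_lt_trans _ _ (\int[leb]_(t in `[0%R, 1%R]) (\sum_j B j)%:E)%E).
    apply: le_integral_of_le => t /=; rewrite in_itv/= => t01.
      by rewrite lee_fin sumr_ge0// => j _; case: (hB j).
    apply: (@le_trans _ _ (\int[leb]_x \sum_j (`|vel j t x * rho j t x|)%:E)%E).
      rewrite [leLHS]integral_mkcond; apply: le_integral_of_le => x _.
        by apply: sume_ge0 => j _; rewrite lee_fin.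
      rewrite patchE; case: ifP => _; last by apply: sume_ge0 => j _; rewrite lee_fin.
      rewrite sumEFin lee_fin (le_trans (norm_col_le _))// ler_sum// => j _.
      by rewrite mxE.
    rewrite ge0_integral_sum//; last by move=> j; exact: mflux.
    by rewrite -sumEFin; apply: lee_sum => j _; case: (hB j) => _; exact.
  rewrite integral_cst//= [X in (_ * X)%E](lebesgue_measure_itv `[0%R, 1%R]) /= lte_fin ltr01.
  by rewrite sube0 mule1 ltry.
- move=> eta seta keta eta01 j.
  have := @path_continuity_equation R (m j 0) _ _ _ _ _ _ _ (mG0 j) (mG1 j) da db ca' cb'
    (@L0 j) (@pL j) (M0 j) (M1 j) (Sl j 0) eta seta keta eta01.
  move=> h; rewrite -[RHS]h; apply: eq_Rintegral => t _; apply: eq_Rintegral => x _.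
  by rewrite !mxE.
- have : {ae leb, forall x : R, forall j, rho j 0 x = u0 j x}.
    apply: filter_forall => j.
    have := ae_density_quantile (m_u0 j) (u0_ge0 j) (u0D j) (u0m j) (D0 j).
    rewrite /rho /path_density /path_dist (_ : path_map _ _ _ _ 0 = G0 j)//.
    by apply/funext => s; rewrite /path_map a0 b0 mul1r mul0r addr0.
  apply: filterS; first exact: (ae_filter_ringOfSetsType leb).
  move=> x h; apply/colP => j; by rewrite mxE h mu0E.
- have : {ae leb, forall x : R, forall j, rho j 1 x = u1 j x}.
    apply: filter_forall => j.
    have := ae_density_quantile (m_u1 j) (u1_ge0 j) (u1D j) (u1m j) (D0 j).
    rewrite /rho /path_density /path_dist (_ : path_map _ _ _ _ 1 = G1 j)//.
    by apply/funext => s; rewrite /path_map a1 b1 mul1r mul0r add0r.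
  apply: filterS; first exact: (ae_filter_ringOfSetsType leb).
  move=> x h; apply/colP => j; by rewrite mxE h mu1E.
Qed.

Variables (M : 'cV[R]_n -> 'M[R]_n) (C B : R) (Q : 'I_n -> R -> R).
Hypothesis C0 : 0 <= C.
Hypothesis hC : forall z p v q : 'cV[R]_n, cuboid Sl Sr z ->
  (forall j, p j 0 = v j 0 * (z j 0 - Sl j 0)) ->
  (forall j, v j 0 ^+ 2 <= (Sr j 0 - z j 0) * q j 0) ->
  (forall j, 0 <= q j 0) ->
  (action_density Sl Sr M z p <= (C * \sum_j q j 0 * (z j 0 - Sl j 0))%:E)%E.
Hypothesis B0 : 0 <= B.
Hypothesis mQ : forall j, measurable_fun setT (Q j).
Hypothesis Q0 : forall j s, 0 <= Q j s.
(* D j / (a t + b t) bounds the density at time t, so the first factor is the room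
   left below the upper face. *)
Hypothesis speed_le : forall j t s, 0 <= t <= 1 ->
  path_speed (quantile (u0 j) (m j 0)) (quantile (u1 j) (m j 0)) a' b' t s ^+ 2
    <= (Sr j 0 - Sl j 0 - D j / (a t + b t)) * (B * Q j s).

Let E := ((C * B)%:E * \sum_j \int[uniform (m j 0%R)]_s (Q j s)%:E)%E.

Let E_ge0 : (0 <= E)%E.
Proof.
apply: mule_ge0; first by rewrite lee_fin mulr_ge0.
by apply: sume_ge0 => j _; apply: integral_ge0 => s _; rewrite lee_fin.
Qed.

Let m_dist j t : measurable_fun setT (dist j t).
Proof. exact: (measurable_path_dist1 (m j 0) (mG0 j) (mG1 j) da db). Qed.

Let density_le t x : 0 <= t <= 1 ->
  (action_density Sl Sr M (path_state t x) (path_flux t x) <=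
   \sum_j (C * B)%:E * (Q j (dist j t x) * rho j t x)%:E)%E.
Proof.
move=> t01; pose v : 'cV[R]_n := \col_j vel j t x.
pose q : 'cV[R]_n := \col_j (B * Q j (dist j t x)).
apply: (@le_trans _ _ (C * \sum_j q j 0 * (path_state t x j 0 - Sl j 0))%:E).
  apply: (hC (v := v)); first exact: state_cuboid.
  - by move=> j; rewrite !mxE addrC addKr.
  - move=> j; rewrite !mxE; apply: (le_trans (speed_le j _ t01)).
    apply: ler_wpM2r; first by rewrite mulr_ge0.
    by have /andP[_] := rho_itv j x t01; rewrite /L; lra.
  - by move=> j; rewrite mxE mulr_ge0.
rewrite sumEFin lee_fin mulr_sumr le_eqVlt; apply/orP; left; apply/eqP.
by apply: eq_bigr => j _; rewrite !mxE; ring.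
Qed.

(** At each time the speed estimate cancels the room below the upper face, and the
    change of variables to labels gives the same bound C B sum_j int Q_j. *)
Lemma path_action_le : (curve_action Sl Sr M path_state path_flux <= E)%E.
Proof.
rewrite /curve_action; apply: (@le_trans _ _ (\int[leb]_(t in `[0%R, 1%R]) E)%E).
  apply: le_integral_of_le => t /=; rewrite in_itv/= => t01 //.
  have mQrho j : measurable_fun setT (fun x => (Q j (dist j t x) * rho j t x)%:E).
    apply/measurable_EFinP; apply: measurable_funM; last exact: m_rho.
    exact: (measurableT_comp (mQ j) (m_dist j t)).
  have Qrho0 j x : (0 <= (Q j (dist j t x) * rho j t x)%:E)%E.
    by rewrite lee_fin mulr_ge0//; case/andP: (rho_itv j x t01).
  apply: (@le_trans _ _ (\int[leb]_x \sum_j (C * B)%:E * (Q j (dist j t x) * rho j t x)%:E)%E).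
    apply: le_integral_of_le => x _; last exact: density_le.
    by apply: sume_ge0 => j _; rewrite mule_ge0// lee_fin mulr_ge0.
  rewrite ge0_integral_sum//=; first last.
  - by move=> j x _; rewrite mule_ge0// lee_fin mulr_ge0.
  - by move=> j; apply: emeasurable_funM => //; exact: mQrho.
  rewrite /E ge0_sume_distrr; last first.
    by move=> j _; apply: integral_ge0 => s _; rewrite lee_fin.
  apply: lee_sum => j _; rewrite ge0_integralZl_EFin//; [|exact: mQrho|by rewrite mulr_ge0].
  by rewrite (integral_path_density (k := fun _ s =>
    Q j s) (mG0 j) (mG1 j) da db (@L0 j) (@pL j) t01)//; exact: measurable2_snd.
have [Efin|] := boolP (E \is a fin_num); last first.
  by rewrite ge0_fin_numE// -leNgt leye_eq => /eqP ->; rewrite leey.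
rewrite -(fineK Efin) integral_cst//= [X in (_ * X)%E](lebesgue_measure_itv `[0%R,
  1%R]) /= lte_fin ltr01.
by rewrite sube0 mule1.
Qed.

Lemma WM_sqr_le_path : (WM Sl Sr M mu0 mu1 ^+ 2 <= E)%E /\
  ((E < +oo)%E -> WM Sl Sr M mu0 mu1 \is a fin_num).
Proof.
have inf_le : (ereal_inf [set curve_action Sl Sr M muw.1 muw.2 |
    muw in [set muw | curve Sl Sr 1 mu0 mu1 muw.1 muw.2]] <= E)%E.
  apply: le_trans path_action_le; apply: ereal_inf_lbound.
  by exists (path_state, path_flux) => //; exact: path_curve.
split; first exact: sqrte_sqr_le.
move=> Efin; rewrite ge0_fin_numE ?sqrte_ge0//.
apply: (@le_lt_trans _ _ (sqrte E)); first by rewrite lee_sqrt.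
by rewrite -ge0_fin_numE ?sqrte_ge0// sqrte_fin_num// ge0_fin_numE.
Qed.

End PathCurve.

(** * Admissible densities *)

Section Admissible.
Context {R : realType} {n : nat}.
Notation leb := (@lebesgue_measure R).
Variables (Sl Sr m : 'cV[R]_n) (mu : R -> 'cV[R]_n).
Hypothesis adm : admissible Sl Sr m mu.

Definition excess (j : 'I_n) x := mu x j 0 - Sl j 0.

Lemma measurable_excess j : measurable_fun setT (excess j).
Proof. by case: adm => -[mmu _] _ _; apply: measurable_funB => //; exact: mmu. Qed.

Lemma excess_itv j x : 0 <= excess j x <= Sr j 0 - Sl j 0.
Proof. by case: adm => -[_ /(_ x)/(_ j)] + _ _; rewrite /excess; lra. Qed.

Lemma excess_ge0 j x : 0 <= excess j x.
Proof. by case/andP: (excess_itv j x). Qed.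

Lemma second_momentE :
  second_moment (fun x => mu x - Sl) = (\sum_j \int[leb]_x (x ^+ 2 * excess j x)%:E)%E.
Proof.
rewrite /second_moment -ge0_integral_sum//; last 2 first.
- move=> j; apply/measurable_EFinP; apply: measurable_funM; last exact: measurable_excess.
  exact: measurable_funX.
- by move=> j x _; rewrite lee_fin mulr_ge0 ?sqr_ge0 ?excess_ge0.
apply: eq_integral => x _; rewrite sumEFin mulr_sumr; congr _%:E.
by apply: eq_bigr => j _; rewrite !mxE.
Qed.

Lemma excess_moment j : (\int[leb]_x (x ^+ 2 * excess j x)%:E < +oo)%E.
Proof.
apply: le_lt_trans (admissible_moment adm); rewrite second_momentE (bigD1 j)//= leeDl//.
by apply: sume_ge0 => k _; apply: integral_ge0 => x _;
  rewrite lee_fin mulr_ge0 ?sqr_ge0 ?excess_ge0.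
Qed.

End Admissible.

(** * The two choices of coefficients *)

Section Paths.
Context {R : realType}.
Implicit Types t x y d : R.

(** The smoothstep cubics have sum 1 and derivatives vanishing at 0 and 1; the bump
    t^2 (1 - t)^2 is added to one of them so that the sum exceeds 1 in between. *)
Definition dilation_left t := 1 - 3 * t ^+ 2 + 2 * t ^+ 3 + t ^+ 2 * (1 - t) ^+ 2.
Definition dilation_right t := 3 * t ^+ 2 - 2 * t ^+ 3.
Definition dilation_left' t := t * (1 - t) * (- 4 - 4 * t).
Definition dilation_right' t := 6 * t * (1 - t).

Lemma is_derive_dilation_left t : is_derive t 1 dilation_left (dilation_left' t).
Proof. by apply: is_derive_eq; rewrite /dilation_left' /GRing.scale/=; ring. Qed.

Lemma is_derive_dilation_right t : is_derive t 1 dilation_right (dilation_right' t).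
Proof. by apply: is_derive_eq; rewrite /dilation_right' /GRing.scale/=; ring. Qed.

Lemma continuous_dilation_left' : continuous dilation_left'.
Proof.
move=> t; apply: cvgM; first by apply: cvgM => //; apply: cvgB => //; exact: cvg_cst.
by apply: cvgB; [exact: cvg_cst|apply: cvgM => //; exact: cvg_cst].
Qed.

Lemma continuous_dilation_right' : continuous dilation_right'.
Proof.
move=> t; apply: cvgM; first by apply: cvgM => //; exact: cvg_cst.
by apply: cvgB => //; exact: cvg_cst.
Qed.

Lemma dilation_sum t :
  dilation_left t + dilation_right t = 1 + t ^+ 2 * (1 - t) ^+ 2.
Proof. by rewrite /dilation_left /dilation_right; ring. Qed.

Lemma dilation_left_ge0 t : 0 <= t <= 1 -> 0 <= dilation_left t.
Proof.
move=> /andP[t0 t1].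
have -> : dilation_left t = (1 - t) ^+ 2 * (1 + 2 * t + t ^+ 2) by rewrite /dilation_left; ring.
by rewrite mulr_ge0 ?sqr_ge0// addr_ge0 ?sqr_ge0//; lra.
Qed.

Lemma dilation_right_ge0 t : 0 <= t <= 1 -> 0 <= dilation_right t.
Proof.
move=> /andP[t0 t1].
have -> : dilation_right t = t ^+ 2 * (3 - 2 * t) by rewrite /dilation_right; ring.
by rewrite mulr_ge0 ?sqr_ge0//; lra.
Qed.

(** The square of the speed and the room d - d / (1 + k) both vanish like
    k = t^2 (1 - t)^2 at the ends: the former is at most 128 k (x^2 + y^2), the
    latter at least d k / 2. *)
Lemma dilation_speed t x y d B : 0 <= t <= 1 -> 0 < d -> 256 / d <= B ->
  (dilation_left' t * x + dilation_right' t * y) ^+ 2 <=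
  (d - d / (dilation_left t + dilation_right t)) * (B * (x ^+ 2 + y ^+ 2)).
Proof.
move=> /andP[t0 t1] d0 dB; rewrite dilation_sum.
set k := t ^+ 2 * (1 - t) ^+ 2; set q := x ^+ 2 + y ^+ 2.
have k0 : 0 <= k by rewrite mulr_ge0 ?sqr_ge0.
have k1 : k <= 1.
  by rewrite /k -exprMn expr_le1// ?mulr_ge0 ?subr_ge0//; nra.
have q0 : 0 <= q by rewrite addr_ge0 ?sqr_ge0.
apply: (@le_trans _ _ (128 * (k * q))).
  have -> : (dilation_left' t * x + dilation_right' t * y) ^+ 2 =
      k * ((- 4 - 4 * t) * x + 6 * y) ^+ 2.
    by rewrite /dilation_left' /dilation_right' /k; ring.
  rewrite [leRHS]mulrCA; apply: ler_wpM2l => //.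
  apply: (@le_trans _ _ (2 * ((4 + 4 * t) * x) ^+ 2 + 2 * (6 * y) ^+ 2)).
    have := sqr_ge0 ((4 + 4 * t) * x + 6 * y); lra.
  have h1 : (4 + 4 * t) ^+ 2 <= 64 by nra.
  rewrite !exprMn /q.
  have := ler_wpM2r (sqr_ge0 x) h1; have := sqr_ge0 y; lra.
have -> : d - d / (1 + k) = d * k / (1 + k) by field; lra.
rewrite [leRHS]mulrA; have -> : d * k / (1 + k) * B * q = (B * d / (1 + k)) * (k * q) by field; lra.
apply: ler_wpM2r; first exact: mulr_ge0.
rewrite ler_pdivlMr; last lra.
by move: dB; rewrite ler_pdivrMr//; lra.
Qed.

Lemma linear_speed t x y d e B : 0 < d -> d^-1 <= B ->
  (- 1 * x + 1 * y) ^+ 2 <= (e + d - e / (1 - t + t)) * (B * (x - y) ^+ 2).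
Proof.
move=> d0 dB; rewrite subrK divr1 addrAC subrr add0r mulrA.
have -> : (- 1 * x + 1 * y) ^+ 2 = (x - y) ^+ 2 by ring.
rewrite ler_peMl ?sqr_ge0//.
by have := ler_wpM2l (ltW d0) dB; rewrite mulfV// gt_eqF.
Qed.

End Paths.

Lemma ler_sum_ord (R : realType) n (f : 'I_n -> R) j : (forall i, 0 <= f i) ->
  f j <= \sum_i f i.
Proof. by move=> f0; rewrite (bigD1 j)//= lerDl sumr_ge0. Qed.

(** * The two bounds *)

Section Bounds.
Context {R : realType} {n : nat}.
Notation leb := (@lebesgue_measure R).
Variables (Sl Sr : 'cV[R]_n) (M : 'cV[R]_n -> 'M[R]_n) (m_ : 'I_n -> R -> R) (K : R).
Hypothesis S_lt : forall j, Sl j 0 < Sr j 0.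
Hypothesis m_mobility : forall j, scalar_mobility (Sl j 0) (Sr j 0) (m_ j).
Hypothesis K_gt0 : 0 < K.
Hypothesis A_K_posdef : forall z, (cuboid Sl Sr)° z ->
  posdef (K *: invmx (decoupled_mobility m_ z) - invmx (M z)).
Variable m : 'cV[R]_n.

Lemma WM_le_second_moment : exists2 C : R, 0 < C &
  forall mu0 mu1 : R -> 'cV[R]_n,
    admissible Sl Sr m mu0 -> admissible Sl Sr m mu1 ->
    WM Sl Sr M mu0 mu1 \is a fin_num /\
    (WM Sl Sr M mu0 mu1 ^+ 2 <=
       C%:E * (second_moment (fun x => mu0 x - Sl)%R +
               second_moment (fun x => mu1 x - Sl)%R))%E.
Proof.
have [C C0 hC] := action_density_le S_lt m_mobility K_gt0 A_K_posdef.
pose d j := Sr j 0 - Sl j 0.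
have d0 j : 0 < d j by rewrite subr_gt0.
(* A sum serves as a common bound; the added 1 makes it positive if n = 0. *)
pose B := \sum_j 256 / d j + 1.
have dB0 j : 0 <= 256 / d j by rewrite (divr_ge0 (ler0n _ _) (ltW (d0 j))).
have B0 : 0 < B by rewrite ltr_wpDl// sumr_ge0.
have dB j : 256 / d j <= B.
  by rewrite (le_trans (ler_sum_ord (f := fun j => 256 / d j) j dB0))// lerDl.
exists (C * B); first exact: mulr_gt0.
move=> mu0 mu1 adm0 adm1.
have mu0E x j : mu0 x j 0 = Sl j 0 + excess Sl mu0 j x by rewrite addrC subrK.
have mu1E x j : mu1 x j 0 = Sl j 0 + excess Sl mu1 j x by rewrite addrC subrK.
have D0 j := ltW (d0 j).
have DS j : d j <= Sr j 0 - Sl j 0 by [].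
have m0 j := measurable_excess adm0 j.
have m1 j := measurable_excess adm1 j.
have g0 j x := excess_ge0 adm0 j x.
have g1 j x := excess_ge0 adm1 j x.
have D_0 j : {ae leb, forall x, excess Sl mu0 j x <= d j}.
  by apply/aeW => x; case/andP: (excess_itv adm0 j x).
have D_1 j : {ae leb, forall x, excess Sl mu1 j x <= d j}.
  by apply/aeW => x; case/andP: (excess_itv adm1 j x).
have e0 j := admissible_mass adm0 j.
have e1 j := admissible_mass adm1 j.
have v0 j := excess_moment adm0 j.
have v1 j := excess_moment adm1 j.
have mq0 j : measurable_fun setT (quantile (excess Sl mu0 j) (m j 0)).
  exact: measurable_quantile (m0 j) (g0 j) (D_0 j) (e0 j) (D0 j).
have mq1 j : measurable_fun setT (quantile (excess Sl mu1 j) (m j 0)).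
  exact: measurable_quantile (m1 j) (g1 j) (D_1 j) (e1 j) (D0 j).
have [] := @WM_sqr_le_path R n Sl Sr m _ _ d mu0 mu1 mu0E mu1E D0 DS m0 m1 g0 g1
  D_0 D_1 e0 e1 v0 v1 _ _ _ _ is_derive_dilation_left is_derive_dilation_right
  continuous_dilation_left' continuous_dilation_right'
  dilation_left_ge0 dilation_right_ge0 _ _ _ _ _ M C B
  (fun j s => quantile (excess Sl mu0 j) (m j 0) s ^+ 2 + quantile (excess Sl mu1 j) (m j 0) s ^+ 2)
  (ltW C0) hC (ltW B0).
- by move=> t _; rewrite dilation_sum lerDl mulr_ge0 ?sqr_ge0.
- by rewrite /dilation_left; ring.
- by rewrite /dilation_right; ring.
- by rewrite /dilation_left; ring.
- by rewrite /dilation_right; ring.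
- by move=> j; apply: measurable_funD; apply: measurable_funX.
- by move=> j s; rewrite addr_ge0 ?sqr_ge0.
- by move=> j t s t01; exact: (dilation_speed _ _ t01 (d0 j) (dB j)).
have -> : (\sum_j \int[uniform (m j 0%R)]_s
    (quantile (excess Sl mu0 j) (m j 0) s ^+ 2 + quantile (excess Sl mu1 j) (m j 0) s ^+ 2)%:E =
    second_moment (fun x => mu0 x - Sl)%R + second_moment (fun x => mu1 x - Sl)%R)%E.
  rewrite (second_momentE adm0) (second_momentE adm1) -big_split/=; apply: eq_bigr => j _.
  rewrite -(quantile_moment (m0 j) (g0 j) (D_0 j) (e0 j) (D0 j)).
  rewrite -(quantile_moment (m1 j) (g1 j) (D_1 j) (e1 j) (D0 j)).
  rewrite -ge0_integralD//; try by move=> s _; rewrite lee_fin sqr_ge0.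
  - by apply/measurable_EFinP; apply: measurable_funX; exact: mq0.
  - by apply/measurable_EFinP; apply: measurable_funX; exact: mq1.
move=> le fin; split => //; apply: fin.
apply: lte_mul_pinfty => //; first by rewrite lee_fin ltW// mulr_gt0.
exact: lte_add_pinfty (admissible_moment adm0) (admissible_moment adm1).
Qed.

Lemma WM_le_W2 (St : 'cV[R]_n) : (cuboid Sl Sr)° St -> exists2 C : R, 0 < C &
  forall mu0 mu1 : R -> 'cV[R]_n,
    admissible Sl Sr m mu0 -> admissible Sl Sr m mu1 ->
    {ae leb, forall x, forall j, mu0 x j 0 <= St j 0 /\ mu1 x j 0 <= St j 0} ->
    (WM Sl Sr M mu0 mu1 ^+ 2 <=
       C%:E * \sum_(j < n) W2 (fun x => mu0 x j 0 - Sl j 0)%R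
                              (fun x => mu1 x j 0 - Sl j 0)%R ^+ 2)%E.
Proof.
move=> Sti.
have [C C0 hC] := action_density_le S_lt m_mobility K_gt0 A_K_posdef.
pose d j := St j 0 - Sl j 0; pose e j := Sr j 0 - St j 0.
have Stj j : Sl j 0 < St j 0 < Sr j 0 by exact: (interior_cuboid (Sl := Sl) (Sr := Sr) j Sti).
have e0 j : 0 < e j by rewrite subr_gt0; case/andP: (Stj j).
(* A sum serves as a common bound; the added 1 makes it positive if n = 0. *)
pose B := \sum_j (e j)^-1 + 1.
have eB0 j : 0 <= (e j)^-1 by rewrite invr_ge0 ltW.
have B0 : 0 < B by rewrite ltr_wpDl// sumr_ge0.
have eB j : (e j)^-1 <= B.
  by rewrite (le_trans (ler_sum_ord (f := fun j => (e j)^-1) j eB0))// lerDl.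
exists (C * B); first exact: mulr_gt0.
move=> mu0 mu1 adm0 adm1 muSt.
have mu0E x j : mu0 x j 0 = Sl j 0 + excess Sl mu0 j x by rewrite addrC subrK.
have mu1E x j : mu1 x j 0 = Sl j 0 + excess Sl mu1 j x by rewrite addrC subrK.
have D0 j : 0 <= d j by have := Stj j; rewrite /d; lra.
have DS j : d j <= Sr j 0 - Sl j 0 by have := Stj j; rewrite /d; lra.
have m0 j := measurable_excess adm0 j.
have m1 j := measurable_excess adm1 j.
have g0 j x := excess_ge0 adm0 j x.
have g1 j x := excess_ge0 adm1 j x.
have D_0 j : {ae leb, forall x, excess Sl mu0 j x <= d j}.
  move: muSt; apply: filterS; first exact: (ae_filter_ringOfSetsType leb).
  by move=> x /(_ j)[+ _]; rewrite /excess /d; lra.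
have D_1 j : {ae leb, forall x, excess Sl mu1 j x <= d j}.
  move: muSt; apply: filterS; first exact: (ae_filter_ringOfSetsType leb).
  by move=> x /(_ j)[_]; rewrite /excess /d; lra.
have i0 j := admissible_mass adm0 j.
have i1 j := admissible_mass adm1 j.
have v0 j := excess_moment adm0 j.
have v1 j := excess_moment adm1 j.
have mq0 j : measurable_fun setT (quantile (excess Sl mu0 j) (m j 0)).
  exact: measurable_quantile (m0 j) (g0 j) (D_0 j) (i0 j) (D0 j).
have mq1 j : measurable_fun setT (quantile (excess Sl mu1 j) (m j 0)).
  exact: measurable_quantile (m1 j) (g1 j) (D_1 j) (i1 j) (D0 j).
have da (t : R) : is_derive t 1 (fun t : R => 1 - t) (- 1).
  by apply: is_derive_eq; rewrite /GRing.scale/=; ring.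
have db (t : R) : is_derive t 1 (fun t : R => t) 1 by exact: is_derive_id.
have cc (c : R) : continuous (fun _ : R => c) by move=> x; exact: cvg_cst.
have [] := @WM_sqr_le_path R n Sl Sr m _ _ d mu0 mu1 mu0E mu1E D0 DS m0 m1 g0 g1
  D_0 D_1 i0 i1 v0 v1 _ _ _ _ da db (cc (- 1)) (cc 1)
  _ _ _ _ _ _ _ M C B
  (fun j s => (quantile (excess Sl mu0 j) (m j 0) s - quantile (excess Sl mu1 j) (m j 0) s) ^+ 2)
  (ltW C0) hC (ltW B0).
- by move=> t /andP[_]; rewrite subr_ge0.
- by move=> t /andP[].
- by move=> t _; rewrite subrK.
- by rewrite subr0.
- by [].
- by rewrite subrr.
- by [].
- by move=> j; apply: measurable_funX; apply: measurable_funB.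
- by move=> j s; rewrite sqr_ge0.
- move=> j t s t01; have -> : Sr j 0 - Sl j 0 = d j + e j by rewrite /d /e; ring.
  exact: (linear_speed _ _ _ _ (e0 j) (eB j)).
move=> le _; apply: (le_trans le); apply: lee_wpmul2l; first by rewrite lee_fin mulr_ge0 ?ltW.
apply: lee_sum => j _.
exact: (quantile_cost_le_W2 (m0 j) (m1 j) (g0 j) (g1 j) (D_0 j) (D_1 j) (i0 j) (i1 j) (D0 j)).
Qed.

End Bounds.

Theorem proposition4p16 (R : realType) (n : nat) (Sl Sr : 'cV[R]_n)
    (M : 'cV[R]_n -> 'M[R]_n) (m_ : 'I_n -> R -> R) (delta K : R)
    (S_lt : forall j, Sl j 0 < Sr j 0)
    (M_mobility : mobility Sl Sr M)
    (m_mobility : forall j, scalar_mobility (Sl j 0) (Sr j 0) (m_ j))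
    (delta_gt0 : 0 < delta)
    (m_uconcave : forall j x, Sl j 0 < x < Sr j 0 -> derive1n 2 (m_ j) x <= - delta)
    (K_gt0 : 0 < K)
    (A_K_posdef : forall z, (cuboid Sl Sr)° z ->
      posdef (K *: invmx (decoupled_mobility m_ z) - invmx (M z)))
    (m : 'cV[R]_n) (m_ge0 : forall j, 0 <= m j 0) :
  (exists2 C : R, 0 < C &
    forall mu0 mu1 : R -> 'cV[R]_n,
      admissible Sl Sr m mu0 -> admissible Sl Sr m mu1 ->
      WM Sl Sr M mu0 mu1 \is a fin_num /\
      (WM Sl Sr M mu0 mu1 ^+ 2 <=
         C%:E * (second_moment (fun x => mu0 x - Sl)%R +
                 second_moment (fun x => mu1 x - Sl)%R))%E)
  /\
  (forall St : 'cV[R]_n, (cuboid Sl Sr)° St ->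
    exists2 C : R, 0 < C &
    forall mu0 mu1 : R -> 'cV[R]_n,
      admissible Sl Sr m mu0 -> admissible Sl Sr m mu1 ->
      {ae @lebesgue_measure R, forall x, forall j,
        mu0 x j 0 <= St j 0 /\ mu1 x j 0 <= St j 0} ->
      (WM Sl Sr M mu0 mu1 ^+ 2 <=
         C%:E * \sum_(j < n)
           W2 (fun x => mu0 x j 0 - Sl j 0)%R
              (fun x => mu1 x j 0 - Sl j 0)%R ^+ 2)%E).
Proof.
split; first exact: WM_le_second_moment S_lt m_mobility K_gt0 A_K_posdef m.
by move=> St; exact: WM_le_W2 S_lt m_mobility K_gt0 A_K_posdef m St.
Qed.
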